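(* Let $(c,\lambda/\mu)$ be a placed skew shape with $n$ boxes. Define an action of $\tilde H_n$ on the vector space $$\tilde H^{(c,\lambda/\mu)}=\mathbb C\text{-span}\{v_L\mid L\text{ is a standard tableau of shape }\lambda/\mu\}$$ (with the symbols $v_L$ as a basis) by the formulas $$x_i v_L = q^{2c(L(i))}\,v_L,\qquad T_i v_L = (T_i)_{LL}\,v_L + \big(q^{-1}+(T_i)_{LL}\big)\,v_{s_iL},$$ where $s_iL$ is the same as $L$ except that the entries $i$ and $i+1$ are interchanged, $$(T_i)_{LL} = \frac{q-q^{-1}}{1-q^{2(c(L(i))-c(L(i+1)))}},\qquad v_{s_iL}=0\ \text{ if } s_iL \text{ is not a standard tableau},$$ and $L(i)$ denotes the box of $L$ containing the entry $i$. (a) $\tilde H^{(c,\lambda/\mu)}$ is a calibrated irreducible $\tilde H_n$-module. (b) The modules $\tilde H^{(c,\lambda/\mu)}$ are non-isomorphic. (c) Every irreducible calibrated $\tilde H_n$-module is isomorphic to $\tilde H^{(c,\lambda/\mu)}$ for some placed skew shape $(c,\lambda/\mu)$.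
   Context: **Algebra.** Fix $q\in\mathbb C^*$ which is not a root of unity. The affine Hecke algebra $\tilde H_n$ is the unital associative $\mathbb C$-algebra generated by $T_1,\dots,T_{n-1}$ and invertible elements $x_1,\dots,x_n$ with relations: $T_iT_j=T_jT_i$ if $|i-j|>1$; $T_iT_{i+1}T_i=T_{i+1}T_iT_{i+1}$ for $1\le i\le n-2$; $T_i^2=(q-q^{-1})T_i+1$; $x_ix_j=x_jx_i$; and for $\gamma\in\mathbb Z^n$, $x^\gamma=x_1^{\gamma_1}\cdots x_n^{\gamma_n}$, $$x^\gamma T_i=T_ix^{s_i\gamma}+(q-q^{-1})\frac{(x^\gamma-x^{s_i\gamma})x_{i+1}}{x_{i+1}-x_i},$$ where $s_i=(i,i+1)$ swaps coordinates $i,i+1$ of $\gamma$ (the right-hand fraction is a Laurent polynomial). A finite dimensional $\tilde H_n$-module is *calibrated* if it has a basis of simultaneous eigenvectors for $x_1,\dots,x_n$. **Skew shapes.** Partitions are drawn with boxes pushed up and to the left; rows and columns are numbered as for matrices. For partitions $\mu\subseteq\lambda$, the skew shape $\lambda/\mu$ consists of the boxes of $\lambda$ not in $\mu$. A box in row $r$, column $s$ lies on the (major) diagonal of index $s-r$. The boxes of $\lambda/\mu$ are numbered $\mathrm{box}_1,\dots,\mathrm{box}_n$ along major diagonals from southwest to northeast (increasing diagonal index; northwest to southeast within a diagonal). A standard tableau of shape $\lambda/\mu$ is a filling of the boxes with $1,\dots,n$ increasing left to right in each row and top to bottom in each column. **Placed skew shapes.** Let $\mathbb R+i[0,2\pi/\ln(q^2))=\{a+bi\mid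 a\in\mathbb R,\ 0\le b<2\pi/\ln(q^2)\}\subseteq\mathbb C$. If $q$ is a positive real number then $x\mapsto q^{2x}=e^{\ln(q^2)x}$ is a bijection from this set to $\mathbb C^*$. A placed skew shape is a pair $(c,\lambda/\mu)$ consisting of a skew shape $\lambda/\mu$ and a content function $c$ from the boxes of $\lambda/\mu$ to $\mathbb R+i[0,2\pi/\ln(q^2))$ such that: - $c(\mathrm{box}_j)\ge c(\mathrm{box}_i)$ if $i<j$ and $c(\mathrm{box}_j)-c(\mathrm{box}_i)\in\mathbb Z$; - $c(\mathrm{box}_j)=c(\mathrm{box}_i)+1$ if and only if $\mathrm{box}_i$ and $\mathrm{box}_j$ are on adjacent diagonals, the diagonal of $\mathrm{box}_j$ having index one more than that of $\mathrm{box}_i$; - $c(\mathrm{box}_i)=c(\mathrm{box}_j)$ if and only if $\mathrm{box}_i$ and $\mathrm{box}_j$ are on the same diagonal. One visualizes a placed skew shape as a book of pages of infinite graph paper with diagonals indexed by consecutive integers, the pages being numbered by values in $[0,1)+i[0,2\pi/\ln(q^2))$, with a skew shape placed on each page; the content of a box is its page number plus the index of its diagonal on that page.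
   Formalization: (b) is proved up to bijections of boxes preserving content and horizontal/vertical adjacency, as literally distinct pairs, e.g. (1) and (2)/(1) with content 0, give isomorphic modules; the content strip becomes any set stable under integer shifts on which q^{2x} is a bijection to C^*. *)

(* Defs.v *)
(* The field of complex numbers is R[i], for an arbitrary R : realType. *)
From HB Require Import structures.
From mathcomp Require Import all_boot all_order all_algebra perm.
From mathcomp Require Import boolp classical_sets functions reals.
From mathcomp Require Import topology normedtype sequences exp trigo.
From mathcomp Require Import complex zify ring lra.

Set Implicit Arguments.
Unset Strict Implicit.
Unset Printing Implicit Defensive.

Import Order.TTheory GRing.Theory Num.Theory.
Import numFieldNormedType.Exports.

Local Open Scope ring_scope.
Local Open Scope complex_scope.

(* The index set {1, ..., n-1} is 'I_n.-1 and {1, ..., n} is 'I_n, both counted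
   from 0; fst_ix i and snd_ix i are the positions "i" and "i + 1". *)
Definition fst_ix n (i : 'I_n.-1) : 'I_n := widen_ord (leq_pred n) i.

Lemma snd_ix_subproof n (i : 'I_n.-1) : (i.+1 < n)%N.
Proof. by rewrite -ltn_predRL. Qed.

Definition snd_ix n (i : 'I_n.-1) : 'I_n := Ordinal (snd_ix_subproof i).

Definition exponent n := {ffun 'I_n -> int}.

Definition swap_exp n (i : 'I_n.-1) (g : exponent n) : exponent n :=
  [ffun j => g (tperm (fst_ix i) (snd_ix i) j)].

Definition root_exp n (i : 'I_n.-1) : exponent n :=
  [ffun j => (j == fst_ix i)%:Z - (j == snd_ix i)%:Z].

(* The Laurent polynomial (x^g - x^(s_i g)) x_{i+1} / (x_{i+1} - x_i), as a list
   of (coefficient, exponent) pairs; see divided_differenceP. *)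
Definition divided_difference n (i : 'I_n.-1) (g : exponent n) :
    seq (int * exponent n) :=
  let d := g (snd_ix i) - g (fst_ix i) in
  if 0 <= d then [seq (1, g + root_exp i *+ k) | k <- iota 0 `|d|%N]
  else [seq (-1, g - root_exp i *+ k) | k <- iota 1 `|d|%N].

Definition monomial_eval (F : fieldType) n (x : 'I_n -> F) (g : exponent n) : F :=
  \prod_j x j ^ g j.

Lemma monomial_evalD (F : fieldType) n (x : 'I_n -> F) (g h : exponent n) :
  (forall j, x j != 0) ->
  monomial_eval x (g + h) = monomial_eval x g * monomial_eval x h.
Proof.
move=> x0; rewrite /monomial_eval -big_split /=.
by apply: eq_bigr => j _; rewrite !ffunE expfzDr.
Qed.

Lemma fst_neq_snd n (i : 'I_n.-1) : fst_ix i != snd_ix i.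
Proof. by rewrite -val_eqE /= ltn_eqF. Qed.

Lemma monomial_eval_root (F : fieldType) n (x : 'I_n -> F) (i : 'I_n.-1) :
  (forall j, x j != 0) ->
  monomial_eval x (root_exp i) = x (fst_ix i) / x (snd_ix i).
Proof.
move=> x0; rewrite /monomial_eval (bigD1 (fst_ix i)) //= (bigD1 (snd_ix i)) /=; last first.
  by rewrite eq_sym fst_neq_snd.
rewrite big1 => [|j /andP[j1 j2]]; rewrite !ffunE ?eqxx ?(negPf j1) ?(negPf j2) //.
by rewrite (negPf (fst_neq_snd i)) [snd_ix i == _]eq_sym (negPf (fst_neq_snd i)) mulr1.
Qed.

Lemma swap_expE n (i : 'I_n.-1) (g : exponent n) :
  swap_exp i g = g + root_exp i *~ (g (snd_ix i) - g (fst_ix i)).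
Proof.
apply/ffunP => j; rewrite !ffunE.
have -> : (root_exp i *~ (g (snd_ix i) - g (fst_ix i))) j =
   (root_exp i j) *~ (g (snd_ix i) - g (fst_ix i)).
  case: (_ - _) => m; rewrite /intmul; first by rewrite ffunMnE.
  by rewrite ffunE ffunMnE.
rewrite ffunE mulrzz.
case: tpermP => [->|->|/eqP/negPf e1 /eqP/negPf e2].
- by rewrite eqxx (negPf (fst_neq_snd i)) subr0 mul1r addrC subrK.
- rewrite eqxx [snd_ix i == _]eq_sym (negPf (fst_neq_snd i)) sub0r mulN1r opprB.
  by rewrite addrC subrK.
- by rewrite e1 e2 subrr mul0r addr0.
Qed.

Lemma monomial_evalMz (F : fieldType) n (x : 'I_n -> F) (g : exponent n) (m : int) :
  (forall j, x j != 0) ->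
  monomial_eval x (g *~ m) = monomial_eval x g ^ m.
Proof.
move=> x0; rewrite /monomial_eval.
have -> : (\prod_j x j ^ g j) ^ m = \prod_j ((x j ^ g j) ^ m).
  elim/big_rec2: _ => [|j a b _ <-]; first by rewrite exp1rz.
  by rewrite expfzMl.
apply: eq_bigr => j _; rewrite exprz_exp; congr (_ ^ _).
case: m => m; rewrite /intmul; first by rewrite ffunMnE -mulr_natr natz.
by rewrite ffunE ffunMnE -mulr_natr natz NegzE mulrN.
Qed.

Lemma divided_differenceP (F : fieldType) n (x : 'I_n -> F) (i : 'I_n.-1)
    (g : exponent n) : (forall j, x j != 0) ->
  (x (snd_ix i) - x (fst_ix i)) *
    \sum_(t <- divided_difference i g) monomial_eval x t.2 *~ t.1 =
  (monomial_eval x g - monomial_eval x (swap_exp i g)) * x (snd_ix i).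
Proof.
move=> x0; rewrite swap_expE monomial_evalD // monomial_evalMz //.
rewrite monomial_eval_root // /divided_difference.
set d := g _ - g _; set a := x (fst_ix i); set b := x (snd_ix i).
have b0 : b != 0 by exact: x0.
have a0 : a != 0 by exact: x0.
set G := monomial_eval x g; set r := a / b.
have r0 : r != 0 by rewrite mulf_neq0 // invr_eq0.
have E (k : int) : monomial_eval x (g + root_exp i *~ k) = G * r ^ k.
  by rewrite monomial_evalD // monomial_evalMz // monomial_eval_root.
have -> : b - a = b * (1 - r) by rewrite /r; field.
case: ifP => d0; rewrite big_map /=.
- have -> : d = `|d|%N by lia.
  rewrite absz_nat; elim: `|d|%N => [|m IH].
    by rewrite big_nil expr0z; ring.
  rewrite -addn1 iotaD add0n big_cat big_seq1 /= mulrDr IH mulr1z.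
  rewrite pmulrn E addn1 exprSz -exprnP; ring.
- have -> : d = - (`|d|%N : int) by lia.
  rewrite abszN absz_nat; elim: `|d|%N => [|m IH].
    by rewrite big_nil expr0z; ring.
  rewrite -[m.+1]addn1 iotaD big_cat big_seq1 /= mulrDr IH.
  rewrite nmulrn E add1n addn1 mulrN1z.
  have -> : r ^ (- m%:Z) = r ^ (- m.+1%:Z) * r.
    by rewrite -[X in _ * X]expr1z -expfzDr //; congr (_ ^ _); lia.
  ring.
Qed.

Section HeckeModules.
Variable R : realType.
Local Notation C := R[i].

(* A finite-dimensional vector space with a choice of operators for the
   generators T_i and x_i; it is a module over the affine Hecke algebra exactly
   when the defining relations hold, which is is_hecke_module below. *)
Record hecke_data (n : nat) := HeckeData {
  carrier :> vectType C;
  opT : 'I_n.-1 -> 'End(carrier);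
  opX : 'I_n -> 'End(carrier) }.

Definition lfun_expz (V : vectType C) (f : 'End(V)) (m : int) : 'End(V) :=
  match m with
  | Posz k => iter k (fun h => f \o h)%VF \1%VF
  | Negz k => iter k.+1 (fun h => f^-1 \o h)%VF \1%VF
  end.

Definition opX_exp n (M : hecke_data n) (g : exponent n) : 'End(M) :=
  \big[@comp_lfun _ M M M / \1%VF]_(j < n) lfun_expz (opX M j) (g j).

Definition is_hecke_module n (q : C) (M : hecke_data n) : Prop :=
  (forall i j : 'I_n.-1, (i.+1 < j)%N || (j.+1 < i)%N ->
     (opT M i \o opT M j = opT M j \o opT M i)%VF) /\
  (forall i j : 'I_n.-1, (j = i.+1 :> nat) ->
     (opT M i \o opT M j \o opT M i = opT M j \o opT M i \o opT M j)%VF) /\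
  (forall i : 'I_n.-1,
     (opT M i \o opT M i)%VF = (q - q^-1) *: opT M i + \1%VF) /\
  (forall j : 'I_n, lker (opX M j) = 0%VS) /\
  (forall j k : 'I_n, (opX M j \o opX M k = opX M k \o opX M j)%VF) /\
  (forall (i : 'I_n.-1) (g : exponent n),
     (opX_exp M g \o opT M i)%VF =
     (opT M i \o opX_exp M (swap_exp i g))%VF +
     (q - q^-1) *: \sum_(t <- divided_difference i g) opX_exp M t.2 *~ t.1).

Definition calibrated n (M : hecke_data n) : Prop :=
  exists b : (\dim {:M}).-tuple M, basis_of {:M} b /\
    forall (k : 'I_(\dim {:M})) (j : 'I_n),
      exists a : C, opX M j (tnth b k) = a *: tnth b k.

Definition submodule n (M : hecke_data n) (U : {vspace M}) : Prop :=
  (forall i, (opT M i @: U <= U)%VS) /\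
  (forall j, (opX M j @: U <= U)%VS) /\
  (forall j, ((opX M j)^-1%VF @: U <= U)%VS).

Definition irreducible n (M : hecke_data n) : Prop :=
  {:M}%VS <> 0%VS /\
  forall U : {vspace M}, submodule U -> U = 0%VS \/ U = {:M}%VS.

Definition isomorphic n (M N : hecke_data n) : Prop :=
  exists f : 'Hom(M, N), lker f = 0%VS /\ limg f = {:N}%VS /\
    (forall i v, f (opT M i v) = opT N i (f v)) /\
    (forall j v, f (opX M j v) = opX N j (f v)).

End HeckeModules.

Definition is_partition (la : seq nat) : bool :=
  sorted geq la && (0%N \notin la).

Definition included (mu la : seq nat) : Prop :=
  forall r, (nth 0 mu r <= nth 0 la r)%N.

(* Rows and columns are counted from 0; the diagonals are unaffected. *)
Definition box (la mu : seq nat) : finType :=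
  {b : 'I_(size la) * 'I_(head 0%N la) |
    (nth 0 mu b.1 <= b.2)%N && (b.2 < nth 0 la b.1)%N}.

Section Boxes.
Variables la mu : seq nat.
Implicit Types b : box la mu.

Definition row b : nat := (val b).1.
Definition col b : nat := (val b).2.
Definition diag b : int := (col b)%:Z - (row b)%:Z.

(* box_before b b' says that b = box_i and b' = box_j with i < j. *)
Definition box_before b b' : bool :=
  (diag b < diag b') || ((diag b == diag b') && (row b < row b')%N).

(* A tableau is encoded by the map L sending an entry i to the box L(i)
   containing it, that is, by the inverse of the filling. *)
Definition standard n (L : {ffun 'I_n -> box la mu}) : bool :=
  [&& injectiveb L, [forall b, b \in codom L],
    [forall i, forall j, (row (L i) == row (L j)) &&
       (col (L i) < col (L j))%N ==> (i < j)%N] &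
    [forall i, forall j, (col (L i) == col (L j)) &&
       (row (L i) < row (L j))%N ==> (i < j)%N]].

End Boxes.

Section PlacedSkewShapes.
Variable R : realType.
Local Notation C := R[i].

Definition cexp (z : C) : C :=
  (expR (complex.Re z))%:C *
  (cos (complex.Im z) +i* sin (complex.Im z)).

(* q^(2 x), where l is the chosen value of ln (q^2) *)
Definition q2pow (l x : C) : C := cexp (l * x).

(* The set D in which contents take their values.  For q a positive real this
   is R + i[0, 2 pi / ln(q^2)), see content_stripP; for a general q, where that
   interval makes no sense, D may be any set that is stable under translation
   by integers and is mapped bijectively onto C^* by x |-> q^(2 x). *)
Definition content_range (q l : C) (D : set C) : Prop :=
  cexp l = q ^+ 2 /\
  (forall x (m : int), D x -> D (x + m%:~R)) /\
  set_bij D [set z : C | z != 0] (q2pow l).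

(* The absolute value only matters for q < 1, where ln(q^2) < 0. *)
Definition content_strip (q : R) : set C :=
  [set z : C | 0 <= complex.Im z < 2 * pi / `|ln (q ^+ 2)|].

Lemma angle_exists (u v : R) : u ^+ 2 + v ^+ 2 = 1 ->
  exists t : R, [/\ 0 <= t, t < 2 * pi, cos t = u & sin t = v].
Proof.
move=> uv; have pi0 := pi_gt0 R.
have u1 : -1 <= u <= 1 by apply/andP; split; nra.
have [/andP[a0 api] ca] := acos_def u1.
have sa : sin (acos u) = `|v|.
  by rewrite sin_acos // -sqrtr_sqr; congr Num.sqrt; rewrite -uv; ring.
have [v0|v0] := leP 0 v.
  exists (acos u); rewrite ca sa ger0_norm //; split => //.
  by lra.
exists (2 * pi - acos u); rewrite mulr_natl; split.
- by lra.
- have : acos u != 0 by apply: contraL v0 => /eqP a; move: sa; rewrite a sin0 => /esym/eqP; rewrite normr_eq0 => /eqP ->; rewrite ltxx.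
  move=> an; have : 0 < acos u by rewrite lt0r an a0. move=> a1; lra.
- by rewrite addrC cosD2pi cosN.
- by rewrite addrC sinD2pi sinN sa ltr0_norm // opprK.
Qed.

Lemma angle_inj (s t : R) : `|s - t| < 2 * pi -> cos s = cos t -> sin s = sin t ->
  s = t.
Proof.
rewrite ltr_norml => /andP[d1 d2] ec es; apply/eqP; rewrite -subr_eq0.
have c1 : cos (s - t) = 1 by rewrite cosB ec es -!expr2 cos2Dsin2.
have h : sin ((s - t) / 2) = 0.
  have := cos_mulr2n ((s - t) / 2).
  have -> : (s - t) / 2 *+ 2 = s - t by rewrite -mulr_natr; field.
  rewrite c1 => e.
  have := cos2Dsin2 ((s - t) / 2) => e2.
  by apply/eqP; rewrite -sqrf_eq0; apply/eqP; lra.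
have [//|dn0] := eqVneq (s - t) 0.
have [dp|dm] := ltP 0 (s - t).
  have : 0 < (s - t) / 2 < pi by apply/andP; split; lra.
  by move/sin_gt0_pi; rewrite h ltxx.
have : 0 < - ((s - t) / 2) < pi.
  by have := dn0; rewrite neq_lt => /orP[?|?]; apply/andP; split; lra.
by move/sin_gt0_pi; rewrite sinN h oppr0 ltxx.
Qed.

Lemma q2pow_real (y a b : R) :
  q2pow y%:C (a +i* b) = (expR (y * a) * cos (y * b)) +i* (expR (y * a) * sin (y * b)).
Proof. by rewrite /q2pow /cexp; simpc. Qed.

Lemma content_stripP (q : R) : 0 < q -> q != 1 ->
  content_range q%:C (ln (q ^+ 2))%:C (content_strip q).
Proof.
move=> q0 q1; rewrite /content_range /content_strip.
have pi0 := pi_gt0 R.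
have qq0 : 0 < q ^+ 2 by rewrite exprn_gt0.
set y := ln (q ^+ 2).
have ey : expR y = q ^+ 2 by rewrite lnK.
have y0 : y != 0.
  apply: contra q1 => /eqP yy; move: ey; rewrite yy expR0 => /esym/eqP.
  by rewrite sqrf_eq1 => /orP[//|/eqP qN]; move: q0; rewrite qN ltr0N1.
have ny : 0 < `|y| by rewrite normr_gt0.
split; [|split].
- by rewrite /cexp /= cos0 sin0 ey; simpc; rewrite [RHS]expr2; simpc; rewrite -expr2.
- move=> [a b] m /=.
  suff -> : m%:~R = (m%:~R : R)%:C by rewrite /= addr0.
  by rewrite rmorph_int.
split.
- move=> [a b] _ /=; rewrite q2pow_real; apply/negP.
  rewrite eq_complex /= !mulf_eq0 !(gt_eqF (expR_gt0 _)) /= => /andP[/eqP c /eqP s].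
  by have := cos2Dsin2 (y * b); rewrite c s => e; lra.
- move=> [a b] [a' b']; rewrite !inE /= => /andP[b0 b1] /andP[b0' b1'].
  rewrite !q2pow_real => -[ec es].
  have ea : expR (y * a) = expR (y * a').
    apply/eqP; rewrite -(@eqrXn2 _ 2) ?expR_ge0 //; apply/eqP.
    rewrite -[LHS]mulr1 -[RHS]mulr1 -{1}(cos2Dsin2 (y * b)) -(cos2Dsin2 (y * b')).
    by rewrite !mulrDr -!exprMn ec es.
  have /expR_inj/(mulfI y0) <- := ea.
  move: ec es; rewrite -ea => /(mulfI (lt0r_neq0 (expR_gt0 _))) ec.
  move=> /(mulfI (lt0r_neq0 (expR_gt0 _))) es.
  suff /(mulfI y0) -> : y * b = y * b' by [].
  apply: angle_inj => //; rewrite -mulrBr normrM mulrC -ltr_pdivlMr //.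
  by rewrite ltr_norml; apply/andP; split; lra.
- move=> [u v]; rewrite /= eq_complex /= => uv.
  set N := u ^+ 2 + v ^+ 2.
  have N0 : 0 < N.
    rewrite /N lt0r addr_ge0 ?sqr_ge0 // andbT paddr_eq0 ?sqr_ge0 //.
    by rewrite !sqrf_eq0.
  set r := Num.sqrt N.
  have r0 : 0 < r by rewrite sqrtr_gt0.
  have rN : r ^+ 2 = N by rewrite sqr_sqrtr // ltW.
  have sy2 : Num.sg y ^+ 2 = 1 by rewrite sqr_sg y0.
  have [] := @angle_exists (u / r) (Num.sg y * (v / r)).
    by rewrite !exprMn sy2 mul1r -mulrDl -/N exprVn rN divff // gt_eqF.
  move=> t [t0 t1 ct st].
  exists (ln r / y +i* (t / `|y|)) => /=.
    by rewrite divr_ge0 //= ltr_pM2r // invr_gt0.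
  rewrite q2pow_real [y * (ln r / y)]mulrC divfK // lnK ?posrE //.
  have -> : y * (t / `|y|) = Num.sg y * t.
    by rewrite {1}[y]numEsg; field; rewrite gt_eqF.
  have cs : cos (Num.sg y * t) = cos t.
    by case: sgrP y0 => //; rewrite ?mul1r ?mulN1r ?cosN.
  have ss : sin (Num.sg y * t) = Num.sg y * sin t.
    by case: sgrP y0 => //; rewrite ?mul1r ?mulN1r ?sinN.
  rewrite cs ss ct st [Num.sg y * (_ * _)]mulrA -expr2 sy2 mul1r; congr (_ +i* _); field; exact: lt0r_neq0.
Qed.

Record placed_skew_shape (D : set C) (n : nat) := PlacedSkewShape {
  outer : seq nat;
  inner : seq nat;
  outer_partition : is_partition outer;
  inner_partition : is_partition inner;
  inner_included : included inner outer;
  card_boxes : #|box outer inner| = n;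
  content : box outer inner -> C;
  content_in : forall b, D (content b);
  content_mono : forall b b', box_before b b' ->
    (exists m : int, content b' - content b = m%:~R) ->
    content b <= content b';
  content_adj : forall b b',
    content b' = content b + 1 <-> diag b' = diag b + 1;
  content_eq : forall b b', content b = content b' <-> diag b = diag b' }.

(* A placed skew shape is a picture on pages of graph paper in which only the
   diagonals are labelled.  Two presentations (c, la/mu) show the same picture
   when their boxes correspond bijectively, with equal contents and the same
   pairs of horizontally and of vertically adjacent boxes: the coordinates of a
   connected component in la/mu depend on arbitrary choices. *)
Definition same_placed_shape D n (p p' : placed_skew_shape D n) : Prop :=
  exists f : box (outer p) (inner p) -> box (outer p') (inner p'),
    bijective f /\
    (forall b, content (f b) = content b) /\
    (forall b b',
      (row b = row b' /\ col b' = (col b).+1) <->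
      (row (f b) = row (f b') /\ col (f b') = (col (f b)).+1)) /\
    (forall b b',
      (col b = col b' /\ row b' = (row b).+1) <->
      (col (f b) = col (f b') /\ row (f b') = (row (f b)).+1)).

Section ShapeModule.
Variables (q l : C) (D : set C) (n : nat) (p : placed_skew_shape D n).

Definition filling : finType := {ffun 'I_n -> box (outer p) (inner p)}.

Definition tableau : finType := {L : filling | standard L}.

Definition swap_entries (i : 'I_n.-1) (L : filling) : filling :=
  [ffun j => L (tperm (fst_ix i) (snd_ix i) j)].

Definition shape_space : vectType C := {ffun tableau -> C^o}.

(* v_L, which is 0 when L is not standard *)
Definition tab_vec (L : filling) : shape_space :=
  [ffun M : tableau => (val M == L)%:R].

Definition diag_coef (i : 'I_n.-1) (L : filling) : C :=
  (q - q^-1) /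
  (1 - q2pow l (content (L (fst_ix i)) - content (L (snd_ix i)))).

Definition shape_X (j : 'I_n) : 'End(shape_space) :=
  linfun (fun v : shape_space =>
    \sum_(L : tableau) v L *: (q2pow l (content (val L j)) *: tab_vec (val L))).

Definition shape_T (i : 'I_n.-1) : 'End(shape_space) :=
  linfun (fun v : shape_space =>
    \sum_(L : tableau) v L *:
      (diag_coef i (val L) *: tab_vec (val L) +
       (q^-1 + diag_coef i (val L)) *: tab_vec (swap_entries i (val L)))).

Definition shape_module : hecke_data R n := HeckeData shape_T shape_X.

Lemma tab_vec_nonstandard (L : filling) : ~~ standard L -> tab_vec L = 0.
Proof.
move=> nL; apply/ffunP => M; rewrite !ffunE.
by case: eqP => // eL; rewrite -eL (valP M) in nL.
Qed.

Lemma linfun_tab_vec (F : tableau -> shape_space) (L : tableau) :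
  linfun (fun v : shape_space => \sum_(M : tableau) v M *: F M)
    (tab_vec (val L)) = F L.
Proof.
set f := (fun v => _).
have fl : linear f.
  move=> a u v; rewrite /f scaler_sumr -big_split /=.
  by apply: eq_bigr => M _; rewrite !ffunE scalerDl scalerA.
pose g := GRing.isLinear.Build _ _ _ _ f fl.
pose h : {linear shape_space -> shape_space} := HB.pack f g.
rewrite (lfunE h) /= /f (bigD1 L) //= ffunE eqxx scale1r big1 ?addr0 // => M nM.
by rewrite ffunE val_eqE (negPf nM) scale0r.
Qed.

Lemma shape_X_tab_vec j (L : tableau) :
  shape_X j (tab_vec (val L)) =
    q2pow l (content (val L j)) *: tab_vec (val L).
Proof. exact: linfun_tab_vec. Qed.

Lemma shape_T_tab_vec i (L : tableau) :
  shape_T i (tab_vec (val L)) =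
    diag_coef i (val L) *: tab_vec (val L) +
    (q^-1 + diag_coef i (val L)) *: tab_vec (swap_entries i (val L)).
Proof. exact: linfun_tab_vec. Qed.

End ShapeModule.

End PlacedSkewShapes.

(* Main.v *)
(* The intertwiners tau_i = T_i - (q - q^-1) / (1 - x_i / x_(i+1)) permute the
   weight spaces of a calibrated module, satisfy the braid relations, and
   tau_i ^ 2 is a scalar that vanishes exactly when the two weights differ by a
   factor q^(+-2).  From a weight vector v one obtains vectors u_w (w in S_n)
   that span a submodule.  Since a weight of a calibrated module never has equal
   neighbours, equal coordinates never cross along w, so the nonzero u_w have
   distinct weights and form a basis on which the action is explicit.  In an
   irreducible module tau_i kills every weight vector with neighbours in the
   ratio q^(+-2), so the nonzero u_w are determined by the weight alone: an
   irreducible calibrated module is determined by any one of its weights.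

   Between two equal coordinates of a weight both neighbouring values (ratios
   q^2 and q^-2) occur, so the entries on two neighbouring diagonals alternate.
   This is exactly what is needed to place the entries in a skew shape as a
   standard tableau; conversely the contents along a standard tableau determine
   the tableau and the adjacencies of its boxes. *)

Require Import Defs.
From mathcomp Require Import all_boot all_order all_algebra fingroup perm.
From mathcomp Require Import boolp classical_sets functions reals.
From mathcomp Require Import exp trigo complex zify ring.
(* matrix.row, matrix.col and poly.root_exp would otherwise hide those of Defs. *)
Import Defs.

Set Implicit Arguments.
Unset Strict Implicit.
Unset Printing Implicit Defensive.

Import Order.TTheory GRing.Theory Num.Theory.

Local Open Scope ring_scope.

(** * Weight vectors and intertwiners *)

(** The obstacle is that equal coordinates make the denominator of the intertwiner vanish and spoil
    the braid relation. At a nonzero weight vector of a calibrated module the two dangerous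
    configurations are excluded: t_i = t_(i+1) would give x_i a Jordan block, and t_i = t_(i+2)
    would make T_i and T_(i+1) act by equal scalars, forcing q^2 = -1. The hypothesis [q ^+ 4 != 1]
    says that q^2 is neither 1 nor -1, which is what these two arguments use. The zero vector has
    every weight, so an orbit may run on past a vector that has vanished.

    For non-isomorphism one common weight is enough. Isomorphic modules share a sequence of
    contents, hence two tableaux whose boxes are matched by their entries; whether two boxes on
    neighbouring diagonals touch is visible from the order in which the entries visit these
    diagonals. *)

Section Coefficients.
Variables (F : fieldType) (q : F).
Hypotheses (q0 : q != 0) (q4 : q ^+ 4 != 1).

(** The diagonal entry of T_i on a weight vector whose neighbouring weights are a and b. For a = b
    nonzero, division by 0 makes it 0. *)
Definition tcoef (a b : F) : F := (q - q^-1) / (1 - a / b).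

(** The scalar by which the square of the intertwiner acts ([tau_tau]). By [kappaE] it is also the
    product of the coefficients q^-1 + (T_i)_LL belonging to L and to s_i L. *)
Definition kappa (a b : F) : F := 1 + tcoef a b * tcoef b a.

Lemma tcoefE a b : b != 0 -> a != b -> tcoef a b = (q - q^-1) * b / (b - a).
Proof.
move=> b0 ab; have ba : b - a != 0 by rewrite subr_eq0 eq_sym.
by rewrite /tcoef; set z := q - q^-1; field; rewrite b0 ba.
Qed.

Lemma tcoef_add a b : a != 0 -> b != 0 -> a != b ->
  tcoef a b + tcoef b a = q - q^-1.
Proof.
move=> a0 b0 ab; have ba : b != a by rewrite eq_sym.
rewrite !tcoefE //.
have ba' : b - a != 0 by rewrite subr_eq0 eq_sym.
have ab' : a - b != 0 by rewrite subr_eq0.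
field; by rewrite q0 ba' ab'.
Qed.

(** The rational identity behind the braid relation: [tau_braid] and [braid_on_hexagon] both come
    down to it. *)
Lemma tcoef_mul a b c : a != 0 -> b != 0 -> c != 0 -> a != b -> b != c ->
  a != c ->
  tcoef a c * (tcoef a b + tcoef b c - (q - q^-1)) = tcoef a b * tcoef b c.
Proof.
move=> a0 b0 c0 ab bc ac; rewrite !tcoefE //.
have ba' : b - a != 0 by rewrite subr_eq0 eq_sym.
have cb' : c - b != 0 by rewrite subr_eq0 eq_sym.
have ca' : c - a != 0 by rewrite subr_eq0 eq_sym.
field; by rewrite q0 ba' cb' ca'.
Qed.

Lemma kappaC a b : kappa a b = kappa b a.
Proof. by rewrite /kappa mulrC. Qed.

Lemma kappaE a b : a != 0 -> b != 0 -> a != b ->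
  kappa a b = (q^-1 + tcoef a b) * (q^-1 + tcoef b a).
Proof.
move=> a0 b0 ab; have e := tcoef_add a0 b0 ab.
have -> : (q^-1 + tcoef a b) * (q^-1 + tcoef b a) =
  q^-1 * q^-1 + q^-1 * (tcoef a b + tcoef b a) + tcoef a b * tcoef b a by ring.
by rewrite e /kappa; field.
Qed.

Lemma tcoef_eq a b : a != 0 -> b != 0 -> a != b ->
  (q^-1 + tcoef a b == 0) = (a == q ^+ 2 * b).
Proof.
move=> a0 b0 ab; rewrite tcoefE //.
have ba' : b - a != 0 by rewrite subr_eq0 eq_sym.
have -> : q^-1 + (q - q^-1) * b / (b - a) = (q ^+ 2 * b - a) * (q^-1 / (b - a)).
  by field; rewrite q0 ba'.
rewrite mulf_eq0 [X in _ || X]mulf_eq0 !invr_eq0 (negPf q0) (negPf ba') !orbF.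
by rewrite subr_eq0 eq_sym.
Qed.

Lemma kappa_eq0 a b : a != 0 -> b != 0 -> a != b ->
  (kappa a b == 0) = (a == q ^+ 2 * b) || (b == q ^+ 2 * a).
Proof.
by move=> a0 b0 ab; rewrite kappaE // mulf_eq0 !tcoef_eq // eq_sym.
Qed.

Lemma sqr_q_neq1 : q ^+ 2 != 1.
Proof. by apply: contra q4 => /eqP e; rewrite (exprM q 2 2) e expr1n. Qed.

Lemma subq_neq0 : q - q^-1 != 0.
Proof.
apply: contra sqr_q_neq1; rewrite subr_eq0 => /eqP e.
by rewrite expr2 {2}e mulfV.
Qed.

End Coefficients.

Lemma big_comp_lfun1 (K : fieldType) (V : vectType K) (I : eqType)
    (r : seq I) (f : I -> 'End(V)) (i0 : I) : uniq r ->
  (forall i, i != i0 -> f i = \1%VF) ->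
  \big[@comp_lfun _ V V V / \1%VF]_(i <- r) f i =
    if i0 \in r then f i0 else \1%VF.
Proof.
move=> ur fi; elim: r ur => [|i r IH] /=; first by rewrite big_nil.
case/andP=> nir /IH e; rewrite big_cons {}e in_cons.
have [->|ni] := eqVneq i0 i; first by rewrite (negPf nir) /= comp_lfun1r.
by rewrite fi 1?eq_sym //= comp_lfun1l.
Qed.

(** Testing against linear forms turns an identity of vectors into one of scalars, which [ring] can
    decide; [lmod_ring] packages this. *)
Lemma scalar_ext (K : fieldType) (V : vectType K) (v w : V) :
  (forall f : {scalar V}, f v = f w) -> v = w.
Proof.
move=> h; rewrite (coord_vbasis (memvf v)) (coord_vbasis (memvf w)).
by apply: eq_bigr => i _; rewrite (h (coord (vbasis {:V}) i)).
Qed.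

Ltac lmod_ring :=
  apply: scalar_ext => ?; rewrite !(linearD, linearB, linearN, scalarZ) /=; ring.

Lemma lfunB (K : fieldType) (U V : vectType K) (f : 'Hom(U, V)) (x y : U) :
  f (x - y) = f x - f y.
Proof. exact: linearB. Qed.

Lemma lfunD (K : fieldType) (U V : vectType K) (f : 'Hom(U, V)) (x y : U) :
  f (x + y) = f x + f y.
Proof. exact: linearD. Qed.

Lemma lfunZ (K : fieldType) (U V : vectType K) (f : 'Hom(U, V)) (a : K) (x : U) :
  f (a *: x) = a *: f x.
Proof. exact: linearZ. Qed.

Section WeightVectors.
Variables (R : realType) (n : nat) (q : R[i]) (M : hecke_data R n).
Local Notation C := R[i].
Hypothesis q0 : q != 0.
Hypothesis hM : is_hecke_module q M.

Implicit Types (t : 'I_n -> C) (v : M) (i : 'I_n.-1) (j : 'I_n).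

Definition weight_vector t v := forall j, opX M j v = t j *: v.

Definition coord_exp j : exponent n := [ffun k => (k == j)%:Z].

Definition swap_ix i : 'S_n := tperm (fst_ix i) (snd_ix i).

Lemma swap_exp_coord i j : swap_exp i (coord_exp j) = coord_exp (swap_ix i j).
Proof.
apply/ffunP => k; rewrite !ffunE; congr (Posz (nat_of_bool _)).
by rewrite /swap_ix; apply/eqP/eqP => [<-|->]; rewrite tpermK.
Qed.

Lemma monomial_eval_coord t j : monomial_eval t (coord_exp j) = t j.
Proof.
rewrite /monomial_eval (bigD1 j) //= big1 => [|k nk].
  by rewrite ffunE eqxx mulr1.
by rewrite ffunE (negPf nk).
Qed.

Lemma opX_exp_coord j : opX_exp M (coord_exp j) = opX M j.
Proof.
rewrite /opX_exp (@big_comp_lfun1 _ _ _ _ _ j) ?index_enum_uniq //.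
  by rewrite mem_index_enum ffunE eqxx /= comp_lfun1r.
by move=> k nk; rewrite ffunE (negPf nk).
Qed.

Lemma lker_opX j : lker (opX M j) == 0%VS.
Proof. by case: hM => _ [_ [_ [-> _]]]. Qed.

Lemma opX_inj j : injective (opX M j).
Proof. exact/lker0P/lker_opX. Qed.

Lemma weight_neq0 t v j : weight_vector t v -> v != 0 -> t j != 0.
Proof.
move=> tv; apply: contra => /eqP tj; apply/eqP/(@opX_inj j).
by rewrite tv tj scale0r linear0.
Qed.

Lemma lfun_expz_eigen (f : 'End(M)) (a : C) v (m : int) :
  lker f == 0%VS -> a != 0 -> f v = a *: v -> lfun_expz f m v = a ^ m *: v.
Proof.
move=> f0 a0 fv.
have fVv : f^-1%VF v = a^-1 *: v.
  have e := lker0_lfunK f0 v; rewrite fv linearZ /= in e.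
  by rewrite -[in RHS]e scalerA mulVf // scale1r.
have it (g : 'End(M)) b k : g v = b *: v ->
    iter k (fun h => g \o h)%VF \1%VF v = b ^+ k *: v.
  move=> gv; elim: k => [|k IH] /=; first by rewrite id_lfunE scale1r.
  by rewrite comp_lfunE IH linearZ /= gv scalerA -exprSr.
case: m => m; first exact: it.
by rewrite /lfun_expz (it _ _ _ fVv) NegzE -exprnN exprVn.
Qed.

Lemma opX_exp_weight t v (g : exponent n) :
  (forall j, lker (opX M j) == 0%VS) -> weight_vector t v ->
  (forall j, t j != 0) -> opX_exp M g v = monomial_eval t g *: v.
Proof.
move=> lk tv t0; rewrite /opX_exp /monomial_eval.
elim/big_rec2: _ => [|j y f _ e]; first by rewrite id_lfunE scale1r.
rewrite comp_lfunE e linearZ /= (@lfun_expz_eigen _ (t j)) //.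
by rewrite scalerA mulrC.
Qed.

Lemma mulT i v : opT M i (opT M i v) = (q - q^-1) *: opT M i v + v.
Proof.
case: hM => _ [_ [e _]]; rewrite -comp_lfunE e.
by rewrite add_lfunE scale_lfunE id_lfunE.
Qed.

Lemma commT i i' v : (i.+1 < i')%N || (i'.+1 < i)%N ->
  opT M i (opT M i' v) = opT M i' (opT M i v).
Proof. by case: hM => e _ /e h; rewrite -!comp_lfunE h. Qed.

Lemma braidT i i' v : (i' = i.+1 :> nat) ->
  opT M i (opT M i' (opT M i v)) = opT M i' (opT M i (opT M i' v)).
Proof. by case: hM => _ [e _] /e h; rewrite -!comp_lfunE h. Qed.

(** For the monomial x_j the divided difference has at most one term: x_(i+1) if j = i + 1, its
    negative if j = i, and none otherwise. *)
Lemma opX_T t v i j : weight_vector t v -> v != 0 ->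
  opX M j (opT M i v) = t (swap_ix i j) *: opT M i v +
    ((q - q^-1) * ((j == snd_ix i)%:R - (j == fst_ix i)%:R) * t (snd_ix i)) *: v.
Proof.
move=> tv v0; have t0 k := weight_neq0 k tv v0.
have [_ [_ [_ [_ [_ e]]]]] := hM.
rewrite -[opX M j]opX_exp_coord -comp_lfunE e add_lfunE scale_lfunE sum_lfunE.
rewrite comp_lfunE (opX_exp_weight _ lker_opX tv t0) linearZ /= swap_exp_coord.
rewrite monomial_eval_coord; congr (_ + _).
rewrite -mulrA -scalerA; congr (_ *: _).
have rr : coord_exp (snd_ix i) = coord_exp (fst_ix i) - Defs.root_exp i.
  by apply/ffunP => k; rewrite !ffunE opprB addrC subrK.
rewrite /divided_difference !ffunE.
have ns := fst_neq_snd i; have ns' : snd_ix i != fst_ix i by rewrite eq_sym.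
have [->|js] := eqVneq j (snd_ix i).
  rewrite (negPf ns) (negPf ns') /= big_seq1 mulr1z mulr0n addr0.
  by rewrite (opX_exp_weight _ lker_opX tv t0) monomial_eval_coord subr0 mul1r.
have [->|jf] := eqVneq j (fst_ix i).
  rewrite /= big_seq1 mulr1n -rr sub0r mulN1r.
  rewrite mulrN1z opp_lfunE (opX_exp_weight _ lker_opX tv t0) monomial_eval_coord.
  by rewrite scaleNr.
rewrite /= big_nil subrr mul0r scale0r //.
Qed.

(** On a weight vector the quotient x_i / x_(i+1) is a scalar. Passing the weight t as an argument
    avoids inverting 1 - x_i / x_(i+1) as an operator. *)
Definition tau i t v : M := opT M i v - tcoef q (t (fst_ix i)) (t (snd_ix i)) *: v.

Lemma tau_weight i t v : weight_vector t v -> v != 0 ->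
  t (fst_ix i) != t (snd_ix i) -> weight_vector (t \o swap_ix i) (tau i t v).
Proof.
move=> tv v0 tne j; have t0 k := weight_neq0 k tv v0.
rewrite /tau linearB /= linearZ /= (opX_T _ _ tv) // tv.
rewrite scalerBr -addrA; congr (_ + _).
rewrite !scalerA -scalerBl -scaleNr; congr (_ *: _).
rewrite tcoefE //; set a := t _ in tne *; set b := t (snd_ix i) in tne *.
have ba' : b - a != 0 by rewrite subr_eq0 eq_sym.
have ns := fst_neq_snd i; have ns' : snd_ix i != fst_ix i by rewrite eq_sym.
have [->|js] := eqVneq j (snd_ix i).
  rewrite (negPf ns') /swap_ix tpermR -/a -/b /= subr0; field; by rewrite q0 ba'.
have [->|jf] := eqVneq j (fst_ix i).
  rewrite /swap_ix tpermL -/a -/b; rewrite /= ?mulr1n ?mulr0n; field; by rewrite q0 ba'.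
by rewrite /swap_ix tpermD 1?eq_sym //= ?mulr0n subrr; ring.
Qed.

Lemma tau_tau i t v : weight_vector t v -> v != 0 ->
  t (fst_ix i) != t (snd_ix i) ->
  tau i (t \o swap_ix i) (tau i t v) =
    kappa q (t (fst_ix i)) (t (snd_ix i)) *: v.
Proof.
move=> tv v0 tne; have t0 k := weight_neq0 k tv v0.
rewrite /tau /= /swap_ix tpermL tpermR linearB /= linearZ /= mulT.
have := tcoef_add q0 (t0 (fst_ix i)) (t0 (snd_ix i)) tne.
rewrite /kappa; set a := tcoef q (t (fst_ix i)) _.
set b := tcoef q (t (snd_ix i)) _ => <-; lmod_ring.
Qed.

End WeightVectors.

Section CalibratedWeights.
Variables (R : realType) (n : nat) (q : R[i]) (M : hecke_data R n).
Local Notation C := R[i].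
Hypothesis hM : is_hecke_module q M.

Implicit Types (t : 'I_n -> C) (v : M) (i : 'I_n.-1) (j : 'I_n).

Lemma snd_fst_ix i i' : i' = i.+1 :> nat -> snd_ix i = fst_ix i'.
Proof. by move=> e; apply: val_inj; rewrite /= e. Qed.

Lemma swap_ixL i : swap_ix i (fst_ix i) = snd_ix i.
Proof. exact: tpermL. Qed.

Lemma swap_ixR i : swap_ix i (snd_ix i) = fst_ix i.
Proof. exact: tpermR. Qed.

Lemma swap_ixD i j : j != i :> nat -> j != i.+1 :> nat -> swap_ix i j = j.
Proof. by move=> h1 h2; apply: tpermD; rewrite -val_eqE /= eq_sym. Qed.

Lemma tau0 i t : tau q i t (0 : M) = 0.
Proof. by rewrite /tau linear0 scaler0 subr0. Qed.

Lemma tau_comm t v i i' : (i.+1 < i')%N || (i'.+1 < i)%N ->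
  tau q i (t \o swap_ix i') (tau q i' t v) =
  tau q i' (t \o swap_ix i) (tau q i t v).
Proof.
move=> ii; have co := commT hM v ii.
rewrite /tau /= !swap_ixD /=; try lia.
rewrite !(lfunB, lfunZ) co.
move: (opT M i v) (opT M i' v) (opT M i' (opT M i v)) => v1 v2 v21; lmod_ring.
Qed.

Hypothesis q0 : q != 0.

Lemma tau_braid t v i i' : i' = i.+1 :> nat -> (forall j, t j != 0) ->
  t (fst_ix i) != t (snd_ix i) -> t (snd_ix i) != t (snd_ix i') ->
  t (fst_ix i) != t (snd_ix i') ->
  tau q i (t \o swap_ix i \o swap_ix i')
    (tau q i' (t \o swap_ix i) (tau q i t v)) =
  tau q i' (t \o swap_ix i' \o swap_ix i)
    (tau q i (t \o swap_ix i') (tau q i' t v)).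
Proof.
move=> ii t0; have e := snd_fst_ix ii.
set a := t (fst_ix i); set b := t (snd_ix i); set c := t (snd_ix i').
move=> ab bc ac.
have rel := tcoef_mul q0 (t0 _ : a != 0) (t0 _ : b != 0) (t0 _ : c != 0) ab bc ac.
have E1 : swap_ix i' (fst_ix i) = fst_ix i by rewrite swap_ixD //=; lia.
have E2 : swap_ix i (snd_ix i') = snd_ix i' by rewrite swap_ixD //=; lia.
have E3 : swap_ix i' (snd_ix i) = snd_ix i' by rewrite e swap_ixL.
have E4 : swap_ix i' (snd_ix i') = snd_ix i by rewrite e swap_ixR.
rewrite /tau /= -!e !(E1, E2, E3, E4, swap_ixL, swap_ixR).
rewrite -/a -/b -/c.
move: rel; set x := tcoef q a b; set y := tcoef q a c; set w := tcoef q b c => rel.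
have br := braidT hM v ii; have m1 := mulT hM i v; have m2 := mulT hM i' v.
rewrite !(lfunB, lfunZ) br m1 m2.
move: (opT M i v) (opT M i' v) (opT M i' (opT M i v)) (opT M i (opT M i' v))
  (opT M i' (opT M i (opT M i' v))) => v1 v2 v21 v12 v212.
apply: scalar_ext => f; rewrite !(linearD, linearB, linearN, scalarZ) /=.
apply/eqP; rewrite -subr_eq0; apply/eqP.
(* After the quadratic and braid relations, the two sides differ by the defect of [tcoef_mul] times
   T_i v - T_(i+1) v. *)
transitivity ((y * (x + w - (q - q^-1)) - x * w) * (f v1 - f v2)); first by ring.
by rewrite rel subrr mul0r.
Qed.

Hypotheses (q4 : q ^+ 4 != 1) (cM : calibrated M).

(** A diagonalizable x_j has no Jordan block: in the eigenbasis (c_k - a) w_k = 0 and (c_k - a) y_k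
    = w_k leave only w_k = 0. *)
Lemma calibrated_semisimple j (a : C) (y w : M) :
  opX M j y = a *: y + w -> opX M j w = a *: w -> w = 0.
Proof.
have [b [bM hb]] := cM; have fb := basis_free bM.
have /boolp.choice [c hc] := fun k => hb k j.
have X_coord k x : coord b k (opX M j x) = c k * coord b k x.
  rewrite {1}(coord_basis bM (memvf x)) !linear_sum (bigD1 k) //= big1 => [|l nl].
    rewrite addr0 linearZ /= -tnth_nth hc !scalarZ.
    by rewrite (tnth_nth 0) /= coord_free // eqxx mulr1 mulrC.
  rewrite linearZ /= -tnth_nth hc !scalarZ.
  by rewrite (tnth_nth 0) /= coord_free // ?(negPf nl) 1?eq_sym ?(negPf nl) !mulr0.
move=> hy hw; rewrite (coord_basis bM (memvf w)) big1 // => k _.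
have /eqP := congr1 (coord b k) hw; rewrite X_coord scalarZ -subr_eq0 -mulrBl.
rewrite mulf_eq0 subr_eq0 => /orP[/eqP ck|/eqP ->]; last by rewrite scale0r.
have /eqP := congr1 (coord b k) hy; rewrite X_coord linearD /= scalarZ ck.
by rewrite -subr_eq0 opprD addrA subrr sub0r oppr_eq0 => /eqP ->; rewrite scale0r.
Qed.

(** If both coordinates were a, then x_i T_i v = a T_i v - (q - q^-1) a v, a Jordan block with
    nonzero off-diagonal part. *)
Lemma weight_adj_neq t v i : weight_vector t v -> v != 0 ->
  t (fst_ix i) != t (snd_ix i).
Proof.
move=> tv v0; apply/eqP => te.
have h := opX_T hM i (fst_ix i) tv v0.
rewrite swap_ixL eqxx (negPf (fst_neq_snd i)) /= in h.
have /eqP := calibrated_semisimple h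
  ltac:(by rewrite lfunZ tv te !scalerA mulrC).
rewrite scaler_eq0 (negPf v0) orbF !mulf_eq0.
rewrite (negPf (subq_neq0 q0 q4)) (negPf (weight_neq0 hM _ tv v0)) orbF /=.
by rewrite sub0r oppr_eq0 oner_eq0.
Qed.

Lemma tau_weight_cal t v i : weight_vector t v ->
  weight_vector (t \o swap_ix i) (tau q i t v).
Proof.
move=> tv; have [->|v0] := eqVneq v 0.
  by rewrite tau0 => j; rewrite linear0 scaler0.
exact: (tau_weight q0 hM tv v0 (weight_adj_neq i tv v0)).
Qed.

Lemma tau_tau_cal t v i : weight_vector t v ->
  tau q i (t \o swap_ix i) (tau q i t v) =
    kappa q (t (fst_ix i)) (t (snd_ix i)) *: v.
Proof.
move=> tv; have [->|v0] := eqVneq v 0; first by rewrite !tau0 scaler0.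
exact: (tau_tau q0 hM tv v0 (weight_adj_neq i tv v0)).
Qed.

(** Otherwise tau_i v and tau_(i+1) v would have equal neighbouring weights, hence vanish, so that
    T_i and T_(i+1) act on v by scalars x and y with x + y = q - q^-1. The quadratic relation gives
    x y = -1, the braid relation then x = y, so (q - x)^2 = 0 and q^2 = x y = -1. *)
Lemma weight_skip_neq t v i i' : i' = i.+1 :> nat -> weight_vector t v ->
  v != 0 -> t (fst_ix i) != t (snd_ix i').
Proof.
move=> ii tv v0; apply/eqP => te; have e := snd_fst_ix ii.
have t0 j := weight_neq0 hM j tv v0.
have ab := weight_adj_neq i tv v0.
have E1 : swap_ix i' (fst_ix i) = fst_ix i by rewrite swap_ixD //=; lia.
have E2 : swap_ix i (snd_ix i') = snd_ix i' by rewrite swap_ixD //=; lia.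
have /eqP z1 : tau q i t v == 0.
  apply/negPn/negP => h; have := weight_adj_neq i' (tau_weight_cal i tv) h.
  by rewrite /= -e swap_ixR E2 te eqxx.
have /eqP z2 : tau q i' t v == 0.
  apply/negPn/negP => h; have := weight_adj_neq i (tau_weight_cal i' tv) h.
  by rewrite /= e swap_ixL E1 te eqxx.
move/subr0_eq: z1 => z1; move/subr0_eq: z2; rewrite -e -te => z2.
set a := t (fst_ix i) in ab z1 z2; set b := t (snd_ix i) in ab z1 z2.
have sum : tcoef q a b + tcoef q b a = q - q^-1 by apply: tcoef_add => //; exact: t0.
have br := braidT hM v ii; have m1 := mulT hM i v.
move: br m1; rewrite z1 z2 !lfunZ !z1 !z2 !lfunZ z1 z2 !scalerA.
rewrite -[X in _ + X]scale1r -scalerDl.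
set x := tcoef q a b in sum *; set y := tcoef q b a in sum *.
move=> /eqP; rewrite -subr_eq0 -scalerBl scaler_eq0 (negPf v0) orbF => /eqP br.
move=> /eqP; rewrite -subr_eq0 -scalerBl scaler_eq0 (negPf v0) orbF => /eqP m1.
have xy1 : x * y = -1.
  have -> : x * y = - (x * x - ((q - q^-1) * x + 1)) - 1 by rewrite -sum; ring.
  by rewrite m1 oppr0 sub0r.
have xy : x = y.
  have : (x * y) * (x - y) = 0 by rewrite -br; ring.
  by rewrite xy1 mulN1r => /eqP; rewrite oppr_eq0 subr_eq0 => /eqP.
have qx : (q - x) ^+ 2 = 0.
  have e1 : q * (q - q^-1) = q ^+ 2 - 1 by field.
  have -> : (q - x) ^+ 2 = q ^+ 2 - q * (x + x) + x * x by ring.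
  by rewrite {2}xy sum e1 {2}xy xy1; ring.
have q2 : q ^+ 2 = -1.
  move/eqP: qx; rewrite expf_eq0 /= subr_eq0 => /eqP ->.
  by rewrite expr2 {2}xy.
by case/eqP: q4; rewrite (exprM q 2 2) q2; ring.
Qed.

Lemma tau_neq0 t v i : weight_vector t v -> v != 0 ->
  kappa q (t (fst_ix i)) (t (snd_ix i)) != 0 -> tau q i t v != 0.
Proof.
move=> tv v0 k0; apply: contra k0 => /eqP z; move: (tau_tau_cal i tv).
by rewrite z tau0 => /esym/eqP; rewrite scaler_eq0 (negPf v0) orbF.
Qed.

(* Two equal coordinates are moved towards each other by intertwiners until they
   are blocked by neighbours in the ratio q^(+-2). *)
Lemma weight_between t v (j k : 'I_n) : weight_vector t v -> v != 0 ->
  (j < k)%N -> t j = t k ->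
  (exists2 l : 'I_n, (j < l < k)%N & t l = q ^+ 2 * t j) /\
  (exists2 l : 'I_n, (j < l < k)%N & t j = q ^+ 2 * t l).
Proof.
have [m] := ubnP (k - j)%N; elim: m => // m IH in t v j k *.
move=> mjk tv v0 jk tjk; have t0 l := weight_neq0 hM l tv v0.
have jn : (j < n.-1)%N by case: (k) jk => k' /= h1 h2; lia.
have kn : (k.-1 < n.-1)%N by case: (k) jk => k' /= h1 h2; lia.
pose i := Ordinal jn; pose i' := Ordinal kn.
have iE : i = j :> nat by []; have i'E : i' = k.-1 :> nat by [].
have fi : fst_ix i = j by apply: val_inj.
have si' : snd_ix i' = k by apply: val_inj => /=; lia.
have adj := weight_adj_neq i tv v0; rewrite fi in adj.
have adj' := weight_adj_neq i' tv v0; rewrite si' in adj'.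
have j1k : (j.+1 < k)%N.
  rewrite ltn_neqAle jk andbT; apply: contra adj => /eqP e; rewrite tjk.
  by apply/eqP; congr t; apply: val_inj.
(* If the value t j occurs again in between, a shorter interval already suffices. *)
have [[l /andP[/andP[jl lk] /eqP tl]]|none] :=
    pselect (exists l : 'I_n, (j < l < k)%N && (t l == t j)).
  have [|[x hx ex] [y hy ey]] := IH t v j l _ tv v0 jl (esym tl); first by lia.
  by split; [exists x|exists y] => //; lia.
(* If kappa is nonzero, the intertwiner moves the value t j one place inwards without killing v; the
   positions found in the smaller interval are not touched by the swap. *)
have [kap|kap] := eqVneq (kappa q (t j) (t (snd_ix i))) 0; last first.
  have v0' : tau q i t v != 0 by apply: tau_neq0; rewrite ?fi.
  have m1 : (k - snd_ix i < m)%N by rewrite /=; lia.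
  have e1 : (t \o swap_ix i) (snd_ix i) = (t \o swap_ix i) k.
    by rewrite /= swap_ixR fi swap_ixD //; lia.
  have [[x hx ex] [y hy ey]] := IH _ _ _ _ m1 (tau_weight_cal i tv) v0' j1k e1.
  move: hx hy ex ey; rewrite /= swap_ixR fi => hx hy.
  rewrite !swap_ixD /=; try lia.
  by move=> ex ey; split; [exists x|exists y] => //; lia.
have [kap'|kap'] := eqVneq (kappa q (t (fst_ix i')) (t k)) 0; last first.
  have v0' : tau q i' t v != 0 by apply: tau_neq0; rewrite ?si'.
  have m1 : (fst_ix i' - j < m)%N by rewrite /=; lia.
  have j1 : (j < fst_ix i')%N by rewrite /=; lia.
  have e1 : (t \o swap_ix i') j = (t \o swap_ix i') (fst_ix i').
    by rewrite /= swap_ixL si' swap_ixD //=; lia.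
  have [[x hx ex] [y hy ey]] := IH _ _ _ _ m1 (tau_weight_cal i' tv) v0' j1 e1.
  move: hx hy ex ey; rewrite /= => hx hy.
  rewrite !swap_ixD /=; try lia.
  by move=> ex ey; split; [exists x|exists y] => //; lia.
have jl1 : (j < snd_ix i < k)%N by rewrite /=; lia.
have jl2 : (j < fst_ix i' < k)%N by rewrite /=; lia.
have q20 : q ^+ 2 != 0 by rewrite expf_neq0.
move/eqP: kap kap' => + /eqP; rewrite !kappa_eq0 // -tjk.
have [l12|l12] := eqVneq (snd_ix i) (fst_ix i').
  have ii : i' = i.+1 :> nat by have := congr1 val l12 => /= ->.
  by have := weight_skip_neq ii tv v0; rewrite fi si' tjk eqxx.
have lt12 : (snd_ix i < fst_ix i')%N.
  by rewrite ltn_neqAle val_eqE l12 /=; lia.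
(* Both ends are now blocked. Opposite ratios are the two entries sought. With equal ratios the two
   blocking coordinates are themselves equal, and induction between them produces a coordinate t j,
   against [none]. *)
case/orP=> /eqP h1; case/orP=> /eqP h2.
- by split; [exists (fst_ix i')|exists (snd_ix i)].
- have e12 : t (snd_ix i) = t (fst_ix i') by apply: (mulfI q20); rewrite -h1 -h2.
  have [|[x hx ex] _] := IH t v _ _ _ tv v0 lt12 e12; first by rewrite /=; lia.
  case: none; exists x; rewrite ex -h1 eqxx andbT; move: hx => /=; lia.
- have e12 : t (snd_ix i) = t (fst_ix i') by rewrite h1 h2.
  have [|_ [x hx ex]] := IH t v _ _ _ tv v0 lt12 e12; first by rewrite /=; lia.
  case: none; exists x.
  have -> : t x = t j by apply: (mulfI q20); rewrite -ex -h1.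
  by rewrite eqxx andbT; move: hx => /=; lia.
- by split; [exists (snd_ix i)|exists (fst_ix i')].
Qed.

End CalibratedWeights.

(** * Orbits of a weight vector under intertwiners *)

Section PermutationAscents.
Variable n : nat.
Implicit Types (w : 'S_n) (i : 'I_n.-1) (j : 'I_n).

Definition ascent w i : bool := (w (fst_ix i) < w (snd_ix i))%N.

(** Stands in for the length of w as induction measure: the weights n - j decrease with j, so the
    sum grows along every ascent. *)
Definition displacement w : nat := (\sum_(j < n) (n - j) * w j)%N.

Lemma mul_swapE i w j : (swap_ix i * w)%g j = w (swap_ix i j).
Proof. exact: permM. Qed.

Lemma mul_swapL i w : (swap_ix i * w)%g (fst_ix i) = w (snd_ix i).
Proof. by rewrite mul_swapE swap_ixL. Qed.

Lemma mul_swapR i w : (swap_ix i * w)%g (snd_ix i) = w (fst_ix i).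
Proof. by rewrite mul_swapE swap_ixR. Qed.

Lemma mul_swapD i w j : j != i :> nat -> j != i.+1 :> nat ->
  (swap_ix i * w)%g j = w j.
Proof. by move=> h1 h2; rewrite mul_swapE swap_ixD. Qed.

Lemma mul_swapK i : cancel (mulg (swap_ix i)) (mulg (swap_ix i)).
Proof. by move=> w; rewrite mulgA tperm2 mul1g. Qed.

Lemma ascent_swap i w : ascent (swap_ix i * w)%g i = ~~ ascent w i.
Proof.
rewrite /ascent mul_swapL mul_swapR; case: ltngtP => // /val_inj/perm_inj e.
by have := fst_neq_snd i; rewrite e eqxx.
Qed.

Lemma comp_mul_swap T (t : 'I_n -> T) i w :
  t \o (swap_ix i * w)%g = t \o w \o swap_ix i.
Proof. by apply: funext => j /=; rewrite mul_swapE. Qed.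

Lemma displacement_ascent w i : ascent w i ->
  (displacement w < displacement (swap_ix i * w)%g)%N.
Proof.
rewrite /ascent => h; rewrite /displacement.
have ns : snd_ix i != fst_ix i by rewrite eq_sym fst_neq_snd.
rewrite (bigD1 (fst_ix i)) // (bigD1 (snd_ix i)) //=.
rewrite [X in (_ < X)%N](bigD1 (fst_ix i)) // (bigD1 (snd_ix i)) //=.
rewrite mul_swapL mul_swapR !addnA.
have -> : (\sum_(j < n | (j != fst_ix i) && (j != snd_ix i))
    (n - j) * (swap_ix i * w)%g j =
  \sum_(j < n | (j != fst_ix i) && (j != snd_ix i)) (n - j) * w j)%N.
  by apply: eq_bigr => j /andP[h1 h2]; rewrite mul_swapD.
rewrite ltn_add2r.
have -> : (n - i = (n - i.+1).+1)%N by rewrite subnSK //; have := snd_ix_subproof i; lia.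
by rewrite !mulSn; lia.
Qed.

Lemma ascending_perm w : (forall i, ascent w i) -> w = 1%g.
Proof.
move=> asc; have mono (j k : 'I_n) : (j < k)%N -> (w j < w k)%N.
  case: j k => j jn [k kn] /= jk; elim: k => // k IH in kn jk *.
  have kn1 : (k < n.-1)%N by lia.
  have h := asc (Ordinal kn1); rewrite /ascent in h.
  have E1 : fst_ix (Ordinal kn1) = Ordinal (ltnW kn) by apply: val_inj.
  have E2 : snd_ix (Ordinal kn1) = Ordinal kn by apply: val_inj.
  rewrite E1 E2 in h; apply: leq_ltn_trans h.
  have [jk'|jk'] := ltnP j k; first exact/ltnW/IH.
  have -> : Ordinal jn = Ordinal (ltnW kn) by apply: val_inj => /=; lia.
  by [].
have monoV (j k : 'I_n) : (j < k)%N -> (w^-1%g j < w^-1%g k)%N.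
  rewrite -{1}(permKV w j) -{1}(permKV w k) => jk.
  have [//|kj|/val_inj e] := ltngtP (w^-1%g j) (w^-1%g k).
    by have := mono _ _ kj; lia.
  by rewrite e ltnn in jk.
have ge (s : 'S_n) : (forall j k : 'I_n, (j < k)%N -> (s j < s k)%N) ->
    forall j : 'I_n, (j <= s j)%N.
  move=> sm [j jn]; elim: j => // j IH in jn *.
  by apply: leq_ltn_trans (IH (ltnW jn)) _; apply: sm.
apply/permP => j; rewrite perm1; apply: val_inj; apply/eqP.
by rewrite eqn_leq ge // andbT -{2}(permK w j) ge.
Qed.

Lemma ascent_ind (P : 'S_n -> Prop) : P 1%g ->
  (forall w i, ascent w i -> P w -> P (swap_ix i * w)%g) -> forall w, P w.
Proof.
move=> P1 Ps w; have [m] := ubnP (displacement w); elim: m w => // m IH w wm.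
have [/ascending_perm -> //|/existsNP[i /negP ni]] := pselect (forall i, ascent w i).
rewrite -(mul_swapK i w); have asc : ascent (swap_ix i * w)%g i by rewrite ascent_swap.
apply: Ps => //; apply: IH.
by have := displacement_ascent asc; rewrite mul_swapK; lia.
Qed.

Lemma swap_braid i i' w : i' = i.+1 :> nat ->
  (swap_ix i * (swap_ix i' * (swap_ix i * w)) =
   swap_ix i' * (swap_ix i * (swap_ix i' * w)))%g.
Proof.
move=> ii; apply/permP => j; rewrite !mul_swapE; congr (w _).
have e := snd_fst_ix ii.
have [->|j1] := eqVneq j (fst_ix i).
  rewrite swap_ixL [swap_ix i' (fst_ix i)]swap_ixD /=; try lia.
  by rewrite swap_ixL e swap_ixL swap_ixD //=; lia.
have [->|j2] := eqVneq j (snd_ix i).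
  rewrite swap_ixR e swap_ixL [swap_ix i' (fst_ix i)]swap_ixD /=; try lia.
  rewrite swap_ixL [swap_ix i (snd_ix i')]swap_ixD /=; try lia.
  by rewrite swap_ixR -e.
have [->|j3] := eqVneq j (snd_ix i').
  rewrite [swap_ix i (snd_ix i')]swap_ixD /=; try lia.
  by rewrite swap_ixR -e swap_ixR swap_ixD //=; lia.
move: j1 j2 j3; rewrite -!val_eqE /= => j1 j2 j3.
by do ![rewrite swap_ixD; try lia].
Qed.

Lemma swap_comm i i' : (i.+1 < i')%N ->
  (swap_ix i * swap_ix i' = swap_ix i' * swap_ix i)%g.
Proof.
move=> ii; rewrite conjgC; congr (_ * _)%g.
by rewrite [swap_ix i in LHS]/swap_ix tpermJ !swap_ixD //=; lia.
Qed.

End PermutationAscents.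

Section Orbit.
Variables (R : realType) (n : nat) (q : R[i]) (M : hecke_data R n).
Local Notation C := R[i].
Hypotheses (q0 : q != 0) (q4 : q ^+ 4 != 1).
Hypotheses (hM : is_hecke_module q M) (cM : calibrated M).
Variables (t : 'I_n -> C) (v : M).
Hypotheses (tv : weight_vector t v).

Implicit Types (w : 'S_n) (i : 'I_n.-1) (j : 'I_n).

(** Records the vectors reached along all ascending paths from 1 to w; a relation, since
    independence of the path is still to be proved. *)
Inductive orbit_rel : 'S_n -> M -> Prop :=
| orbit_one : orbit_rel 1%g v
| orbit_step w x i : orbit_rel w x -> ascent w i ->
    orbit_rel (swap_ix i * w)%g (tau q i (t \o w) x).

Lemma orbit_rel_weight w x : orbit_rel w x -> weight_vector (t \o w) x.
Proof.
elim=> [|{}w {}x i _ wx _]; first by move=> j; rewrite /= perm1 tv.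
by rewrite comp_mul_swap; exact: tau_weight_cal.
Qed.

Lemma orbit_rel_inv w x : orbit_rel w x ->
  (w = 1%g /\ x = v) \/
  exists i y, [/\ ~~ ascent w i, orbit_rel (swap_ix i * w)%g y &
    x = tau q i (t \o (swap_ix i * w)%g) y].
Proof.
case=> [|{}w {}x i wx asc]; first by left.
by right; exists i, x; rewrite mul_swapK ascent_swap negbK.
Qed.

Lemma orbit_rel_ex w : exists x, orbit_rel w x.
Proof.
elim/ascent_ind: w => [|w i asc [x wx]]; first by exists v; exact: orbit_one.
by exists (tau q i (t \o w) x); exact: orbit_step.
Qed.

(** A confluence argument replaces Matsumoto's theorem. Two different last steps i and i' are
    completed downwards to a commuting square or to a braid hexagon. Its lowest vertex w0 has some
    vector z, and by induction the two intermediate vectors are obtained from z. *)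
Lemma orbit_rel_uniq w x y : orbit_rel w x -> orbit_rel w y -> x = y.
Proof.
have [m] := ubnP (displacement w); elim: m w x y => // m IH w x y wm.
have desc i : ~~ ascent w i -> (displacement (swap_ix i * w)%g < m)%N.
  rewrite -ascent_swap => /displacement_ascent; rewrite mul_swapK; lia.
have asc1 i : ascent (1%g : 'S_n) i by rewrite /ascent !perm1 /=.
move=> /orbit_rel_inv[[w1 ->]|[i [x' [ni wx' ->]]]];
  move=> /orbit_rel_inv[[w1' ->]|[i' [y' [ni' wy' ->]]]] //.
- by rewrite w1 asc1 in ni'.
- by rewrite w1' asc1 in ni.
wlog ii : i i' x' y' ni ni' wx' wy' / (i <= i')%N.
  move=> h; have [|/ltnW] := leqP i i'; first exact: h.
  by move=> ?; apply/esym/h.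
have dn := ltnW (desc _ ni); have dn' := ltnW (desc _ ni').
move: ii; rewrite leq_eqVlt => /orP[/eqP/val_inj ii|].
  by subst i'; rewrite (IH _ _ _ (desc _ ni) wx' wy').
rewrite leq_eqVlt => /orP[/eqP/esym ii|ii].
  have e := snd_fst_ix ii.
  (* Both i and i' are descents of w, so w decreases on the three positions involved; w0 takes the
     same values there in increasing order. *)
  pose w0 := (swap_ix i * (swap_ix i' * (swap_ix i * w)))%g.
  have w0E : w0 = (swap_ix i' * (swap_ix i * (swap_ix i' * w)))%g by exact: swap_braid.
  have [z wz] := orbit_rel_ex w0.
  have E1 : swap_ix i' (fst_ix i) = fst_ix i by rewrite swap_ixD //=; lia.
  have E2 : swap_ix i (snd_ix i') = snd_ix i' by rewrite swap_ixD //=; lia.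
  have wE1 : w0 (fst_ix i) = w (snd_ix i').
    by rewrite /w0 !mul_swapE swap_ixL e swap_ixL E2.
  have wE2 : w0 (snd_ix i) = w (snd_ix i).
    by rewrite /w0 !mul_swapE swap_ixR E1 swap_ixL.
  have wE3 : w0 (snd_ix i') = w (fst_ix i).
    by rewrite /w0 !mul_swapE E2 swap_ixR -e swap_ixR.
  move: (ni) (ni'); rewrite /ascent -e -!leqNgt => d1 d2.
  have d1' : (w (snd_ix i) < w (fst_ix i))%N.
    rewrite ltn_neqAle d1 andbT val_eqE (inj_eq perm_inj) eq_sym.
    exact: fst_neq_snd.
  have d2' : (w (snd_ix i') < w (snd_ix i))%N.
    rewrite ltn_neqAle d2 andbT val_eqE (inj_eq perm_inj) eq_sym e.
    exact: fst_neq_snd.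
  have a1 : ascent w0 i by rewrite /ascent wE1 wE2.
  have a2 : ascent w0 i' by rewrite /ascent -e wE2 wE3.
  have a3 : ascent (swap_ix i * w0)%g i'.
    by rewrite /ascent -e mul_swapR mul_swapE E2 wE1 wE3; lia.
  have a4 : ascent (swap_ix i' * w0)%g i.
    by rewrite /ascent e mul_swapL mul_swapE E1 wE1 wE3; lia.
  have r1 := orbit_step (orbit_step wz a1) a3.
  have r2 := orbit_step (orbit_step wz a2) a4.
  have x1 : (swap_ix i' * (swap_ix i * w0) = swap_ix i * w)%g.
    by rewrite /w0 !mul_swapK.
  have x2 : (swap_ix i * (swap_ix i' * w0) = swap_ix i' * w)%g.
    by rewrite w0E !mul_swapK.
  rewrite x1 in r1; rewrite x2 in r2.
  rewrite (IH _ _ _ (desc _ ni) wx' r1) (IH _ _ _ (desc _ ni') wy' r2).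
  clearbody w0; rewrite -x1 -x2 !comp_mul_swap.
  (* Distinct coordinates, which the braid relation requires, are guaranteed only at a nonzero
     vector. *)
  have [->|z0] := eqVneq z 0; first by rewrite !tau0.
  have wtz := orbit_rel_weight wz.
  apply: (tau_braid hM q0 (t := t \o w0)) => //.
  - by move=> j; exact: (weight_neq0 hM _ wtz z0).
  - exact: (weight_adj_neq hM q0 q4 cM _ wtz z0).
  - by rewrite e; exact: (weight_adj_neq hM q0 q4 cM _ wtz z0).
  - exact: (weight_skip_neq hM q0 q4 cM ii wtz z0).
pose w0 := (swap_ix i * (swap_ix i' * w))%g.
have co : (swap_ix i' * (swap_ix i * w))%g = w0.
  by rewrite /w0 !mulgA (swap_comm ii).
have [z wz] := orbit_rel_ex w0.
have d1 : ascent w0 i by rewrite /w0 ascent_swap /ascent !mul_swapD //=; lia.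
have d2 : ascent w0 i' by rewrite -co ascent_swap /ascent !mul_swapD //=; lia.
have r1 := orbit_step wz d2; have r2 := orbit_step wz d1.
have x1 : (swap_ix i' * w0 = swap_ix i * w)%g by rewrite -co mul_swapK.
have x2 : (swap_ix i * w0 = swap_ix i' * w)%g by rewrite /w0 mul_swapK.
rewrite x1 in r1; rewrite x2 in r2.
rewrite (IH _ _ _ (desc _ ni) wx' r1) (IH _ _ _ (desc _ ni') wy' r2).
clearbody w0; rewrite -x1 -x2 !comp_mul_swap.
by apply: (tau_comm hM); rewrite ii ?orbT.
Qed.

End Orbit.

(** Separation of eigenvalues: choose j where the weights of k and k' differ; x_j - s_k'(j) kills
    the term k' and rescales the others, the term k by a nonzero factor. For U = 0 this is the
    independence of vectors with distinct weights. *)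
Lemma weight_sum_mem (R : realType) n (M : hecke_data R n) (U : {vspace M})
    (I : finType) (P : {pred I}) (s : I -> 'I_n -> R[i]) (y : I -> M) :
  (forall j, (opX M j @: U <= U)%VS) ->
  (forall k, k \in P -> weight_vector (s k) (y k)) ->
  {in P &, injective s} -> \sum_(k in P) y k \in U ->
  forall k, k \in P -> y k \in U.
Proof.
move=> XU; have [m] := ubnP #|P|; elim: m P y => // m IH P y Pm wy sP yU k kP.
have [k' /andP[k'P nk]|P1] := pickP [pred k' | (k' \in P) && (k' != k)]; last first.
  move: yU; rewrite (bigD1 k) //= big1 ?addr0 // => l lP.
  by have := P1 l; rewrite /= lP.
have [j sj] : exists j, s k j != s k' j.
  apply: contrapT => /forallNP h; case/eqP: nk; apply: sP => //; apply/esym/funext => j.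
  by have /negP/negPn/eqP := h j.
pose P' := [pred l in P | l != k'].
pose y' l := (s l j - s k' j) *: y l.
suff : y' k \in U.
  move=> h; have -> : y k = (s k j - s k' j)^-1 *: y' k.
    by rewrite scalerA mulVf ?scale1r // subr_eq0.
  exact: memvZ.
apply: (IH P' y') => //.
- move: Pm; rewrite (cardD1 k') k'P add1n ltnS; congr (_ < _)%N.
  by apply: eq_card => l; rewrite !inE andbC.
- move=> l /andP[lP _] j'; rewrite /y' lfunZ wy // !scalerA mulrC //.
- by move=> l l' /andP[lP _] /andP[l'P _]; exact: sP.
- have -> : \sum_(l in P') y' l =
      opX M j (\sum_(l in P) y l) - s k' j *: \sum_(l in P) y l.
    rewrite linear_sum scaler_sumr -sumrB (bigD1 k' k'P) /= wy // subrr add0r.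
    by apply: eq_big => // l /andP[lP _]; rewrite /y' scalerBl wy.
  by rewrite memvB ?memvZ //; apply: subvP (XU j) _ _; exact: memv_img.
- by rewrite inE /= kP eq_sym.
Qed.

Section OrderOnLevels.
Variables (n : nat) (T : eqType) (t : 'I_n -> T).
Implicit Types (w : 'S_n) (i : 'I_n.-1).

Definition keeps_order w : Prop :=
  forall j k : 'I_n, (j < k)%N -> t j = t k -> (w^-1%g j < w^-1%g k)%N.

Lemma keeps_order1 : keeps_order 1%g.
Proof. by move=> j k; rewrite invg1 !perm1. Qed.

Lemma keeps_order_swap w i : t (w (fst_ix i)) != t (w (snd_ix i)) ->
  keeps_order w -> keeps_order (swap_ix i * w)%g.
Proof.
move=> adj kw j k jk tjk; have {kw} := kw _ _ jk tjk.
have E l : ((swap_ix i * w)^-1)%g l = swap_ix i (w^-1%g l).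
  by rewrite invMg permM /swap_ix tpermV.
rewrite !E -[in t j](permKV w j) -[in t k](permKV w k) in tjk *.
move: (w^-1%g j) (w^-1%g k) tjk => a b tab ab.
have [a1|a1] := eqVneq a (fst_ix i).
  have [b1|b1] := eqVneq b (snd_ix i); first by rewrite -a1 -b1 /= tab eqxx in adj.
  rewrite a1 swap_ixL swap_ixD //=; move: ab b1; rewrite a1 -val_eqE /=; lia.
have [a2|a2] := eqVneq a (snd_ix i).
  move: ab; rewrite a2 swap_ixR /= => ab; rewrite swap_ixD /=; lia.
rewrite [swap_ix i a]swap_ixD //.
have [b1|b1] := eqVneq b (fst_ix i).
  by move: ab; rewrite b1 swap_ixL /=; lia.
have [b2|b2] := eqVneq b (snd_ix i).
  by move: ab a1; rewrite b2 swap_ixR /= -val_eqE /=; lia.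
by rewrite swap_ixD.
Qed.

(** At the first position where w and w' differ, they pick different entries of the same value. The
    smaller entry must precede the larger one in both arrangements, so it would already have been
    picked earlier, where they agree. *)
Lemma keeps_order_inj w w' : keeps_order w -> keeps_order w' ->
  t \o w = t \o w' -> w = w'.
Proof.
move=> uw uw' e; apply/permP => -[j jn].
have [m] := ubnP j; elim: m => // m IH in j jn *; rewrite ltnS => jm.
have te := congr1 (fun f => f (Ordinal jn)) e; rewrite /= in te.
have aux (x y : 'S_n) : keeps_order x -> keeps_order y ->
    t (x (Ordinal jn)) = t (y (Ordinal jn)) ->
    (forall k (kn : (k < n)%N), (k < m)%N -> x (Ordinal kn) = y (Ordinal kn)) ->
    (x (Ordinal jn) < y (Ordinal jn))%N -> False.
  move=> ux uy txy xy lt; have := uy _ _ lt txy; rewrite permK.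
  set k := (y^-1)%g _ => kj.
  have yk : y k = x (Ordinal jn) by rewrite /k permKV.
  move: kj yk; case: k => k kn /= kj; rewrite -xy; last by lia.
  by move=> /perm_inj [ke]; lia.
have IH' k (kn : (k < n)%N) : (k < m)%N -> w (Ordinal kn) = w' (Ordinal kn) by exact: IH.
have [lt|lt|/val_inj //] := ltngtP (w (Ordinal jn)) (w' (Ordinal jn)).
- by case: (aux w w' uw uw' te IH' lt).
- by case: (aux w' w uw' uw (esym te) (fun k kn km => esym (IH' k kn km)) lt).
Qed.

End OrderOnLevels.

Section OrbitFunction.
Variables (R : realType) (n : nat) (q : R[i]) (M : hecke_data R n).
Local Notation C := R[i].
Hypotheses (q0 : q != 0) (q4 : q ^+ 4 != 1).
Hypotheses (hM : is_hecke_module q M) (cM : calibrated M).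

Implicit Types (w : 'S_n) (i : 'I_n.-1) (j : 'I_n) (t : 'I_n -> C) (u : 'S_n -> M).

(* u w is the image of u 1 under the product of intertwiners along any reduced
   word of w. *)
Definition tau_orbit t u : Prop :=
  forall w i, ascent w i -> u (swap_ix i * w)%g = tau q i (t \o w) (u w).

Lemma tau_orbit_ex t v : weight_vector t v ->
  exists2 u, tau_orbit t u & u 1%g = v.
Proof.
move=> tv; have /boolp.choice[u hu] := @orbit_rel_ex _ _ q _ t v.
exists u => [w i asc|].
  apply: (orbit_rel_uniq q0 q4 hM cM tv (hu _)).
  exact: orbit_step.
exact: (orbit_rel_uniq q0 q4 hM cM tv (hu _) (orbit_one _ _ _)).
Qed.

Variables (t : 'I_n -> C) (u : 'S_n -> M).
Hypotheses (tu : weight_vector t (u 1%g)) (hu : tau_orbit t u).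

Lemma orbit_weight w : weight_vector (t \o w) (u w).
Proof.
elim/ascent_ind: w => [j|w i asc IH]; first by rewrite /= perm1 tu.
by rewrite comp_mul_swap hu //; exact: tau_weight_cal.
Qed.

(** On a descent u w is itself the image of u (s_i w) under tau_i, so another tau_i gives back kappa
    times u (s_i w). *)
Lemma orbit_T w i :
  opT M i (u w) = tcoef q (t (w (fst_ix i))) (t (w (snd_ix i))) *: u w +
    (if ascent w i then 1 else kappa q (t (w (fst_ix i))) (t (w (snd_ix i)))) *:
      u (swap_ix i * w)%g.
Proof.
case: ifP => [asc|/negbT nasc].
  by rewrite hu // scale1r /tau /= addrC subrK.
rewrite -ascent_swap in nasc; have := hu nasc; rewrite mul_swapK => e.
have := tau_tau_cal hM q0 q4 cM i (orbit_weight (swap_ix i * w)%g).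
rewrite -e -comp_mul_swap mul_swapK /= mul_swapL mul_swapR /tau /= kappaC => /eqP.
by rewrite subr_eq addrC => /eqP.
Qed.

Lemma orbit_order w : u w != 0 -> keeps_order t w.
Proof.
elim/ascent_ind: w => [_|w i asc IH]; first exact: keeps_order1.
rewrite hu // => z; have uw0 : u w != 0.
  by apply: contra z => /eqP ->; rewrite tau0.
apply: keeps_order_swap (IH uw0).
exact: (weight_adj_neq hM q0 q4 cM i (orbit_weight w) uw0).
Qed.

Lemma orbit_submodule : submodule (<<codom u>>)%VS.
Proof.
have uU w : u w \in (<<codom u>>)%VS by apply: memv_span; exact: codom_f.
have img (f : 'End(M)) : (forall w, f (u w) \in (<<codom u>>)%VS) ->
    (f @: <<codom u>> <= <<codom u>>)%VS.
  move=> fu; rewrite limg_span; apply/span_subvP => _ /mapP[_ /codomP[w ->] ->].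
  exact: fu.
split; [|split] => j; apply: img => w.
- by rewrite orbit_T memvD ?memvZ.
- by rewrite orbit_weight memvZ.
- have [->|z] := eqVneq (u w) 0; first by rewrite linear0 mem0v.
  have e := lker0_lfunK (lker_opX hM j) (u w); rewrite orbit_weight lfunZ in e.
  have -> : (opX M j)^-1%VF (u w) = ((t \o w) j)^-1 *: u w.
    rewrite -[in RHS]e scalerA mulVf ?scale1r //.
    exact: (weight_neq0 hM _ (orbit_weight w) z).
  by rewrite memvZ.
Qed.

Hypotheses (u1 : u 1%g != 0) (irrM : irreducible M).

Lemma orbit_full : <<codom u>>%VS = {:M}%VS.
Proof.
have [_ /(_ _ orbit_submodule) [e|//]] := irrM.
by case/negP: u1; rewrite -memv0 -e memv_span // codom_f.
Qed.

Lemma orbit_linear_ext (N : vectType C) (f g : 'Hom(M, N)) :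
  (forall w, f (u w) = g (u w)) -> f = g.
Proof.
move=> fg; apply/(fullv_lfunP _ _ orbit_full) => _ /codomP[w ->]; exact: fg.
Qed.

End OrbitFunction.

Lemma mem_span_codom (K : fieldType) (V : vectType K) (I : finType) (u : I -> V) x :
  x \in <<codom u>>%VS -> exists c : I -> K, x = \sum_w c w *: u w.
Proof.
rewrite span_def big_image /= => /memv_sumP[y yP ->].
have /boolp.choice[c hc] : forall w, exists c, y w = c *: u w.
  by move=> w; apply/vlineP/yP.
by exists c; apply: eq_bigr => w _; exact: hc.
Qed.

(** * An irreducible calibrated module is determined by one weight *)

Section Uniqueness.
Variables (R : realType) (n : nat) (q : R[i]).
Local Notation C := R[i].
Hypotheses (q0 : q != 0) (q4 : q ^+ 4 != 1).

Implicit Types (w : 'S_n) (i : 'I_n.-1) (t : 'I_n -> C) (M N : hecke_data R n).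

(* If tau v were nonzero then v would be in the span of the orbit of tau v, and
   by comparing weights it would be a multiple of tau (tau v) = 0. *)
Lemma tau_irr_eq0 M t (v : M) i : is_hecke_module q M -> calibrated M ->
  irreducible M -> weight_vector t v -> v != 0 ->
  kappa q (t (fst_ix i)) (t (snd_ix i)) = 0 -> tau q i t v = 0.
Proof.
move=> hM cM irrM tv v0 k0; apply/eqP/negPn/negP => v'0.
have tv' := tau_weight_cal hM q0 q4 cM i tv.
have [u hu u1] := tau_orbit_ex q0 q4 hM cM tv'.
have adj := weight_adj_neq hM q0 q4 cM i tv v0.
set t' := t \o swap_ix i in tv' hu.
rewrite -u1 in tv' v'0.
pose s := (swap_ix i * 1)%g.
have asc : ascent (1%g : 'S_n) i by rewrite /ascent !perm1 /=.
have us0 : u s = 0.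
  rewrite hu // u1 -[RHS](scale0r v) -k0 -(tau_tau_cal hM q0 q4 cM i tv).
  by congr (tau q i _ _); apply: funext => j; rewrite /= perm1.
have t's : t' \o s = t.
  by apply: funext => j /=; rewrite /s mulg1 /t' /= /swap_ix tpermK.
have ks : keeps_order t' s.
  apply: keeps_order_swap (@keeps_order1 _ _ _).
  by rewrite !perm1 /t' /= swap_ixL swap_ixR eq_sym.
have [c vE] : exists c : 'S_n -> C, v = \sum_w c w *: u w.
  by apply: mem_span_codom; rewrite (orbit_full q0 q4 hM cM tv' hu v'0 irrM) memvf.
(* The index s is kept although u s = 0: its term contains -v, which has the weight t' \o s. The
   terms y w then sum to 0, and separating weights yields v = 0. *)
pose P := [pred w | (u w != 0) || (w == s)].
pose y w := c w *: u w - (w == s)%:R *: v.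
have kP w : w \in P -> keeps_order t' w.
  by case/orP=> [/(orbit_order q0 q4 hM cM tv' hu)|/eqP ->].
suff /(_ s) : forall w, w \in P -> y w \in 0%VS.
  rewrite inE eqxx orbT memv0 /y us0 scaler0 eqxx scale1r sub0r oppr_eq0.
  by rewrite (negPf v0) => /(_ isT).
apply: (@weight_sum_mem _ _ M 0 _ P (fun w => t' \o w)).
- by move=> j; rewrite limg0 subvv.
- move=> w _ j; rewrite /y lfunB !lfunZ (orbit_weight q0 q4 hM cM tv' hu).
  have [->|ws] := eqVneq w s; last by rewrite /= !mulr0n !scale0r !subr0 !scalerA mulrC.
  by rewrite tv !scale1r t's scalerBr !scalerA mulrC.
- by move=> w w' /kP kw /kP kw'; exact: keeps_order_inj.
- rewrite big_mkcond /= (eq_bigr y) => [|w _]; last first.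
    case: ifP => // /negbT; rewrite inE negb_or negbK => /andP[/eqP uw /negPf ws].
    by rewrite /y uw ws scaler0 scale0r subr0.
  rewrite sumrB -vE (bigD1 s) //= eqxx scale1r big1 => [|w /negPf ->].
    by rewrite addr0 subrr mem0v.
  by rewrite scale0r.
Qed.

Lemma orbit_ascent_neq0 M t (u : 'S_n -> M) w i : is_hecke_module q M ->
  calibrated M -> irreducible M -> weight_vector t (u 1%g) ->
  tau_orbit q t u -> ascent w i ->
  (u (swap_ix i * w)%g != 0) =
    (u w != 0) && (kappa q (t (w (fst_ix i))) (t (w (snd_ix i))) != 0).
Proof.
move=> hM cM irrM tu hu asc; rewrite hu //.
have tw := orbit_weight q0 q4 hM cM tu hu w.
have [->|uw] := eqVneq (u w) 0; first by rewrite tau0 eqxx.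
have [k0|k0] := eqVneq (kappa _ _ _) 0.
  by rewrite (tau_irr_eq0 hM cM irrM tw uw k0) eqxx.
by rewrite (tau_neq0 hM q0 q4 cM tw).
Qed.

Lemma orbit_neq0_eq M N t (u : 'S_n -> M) (u' : 'S_n -> N) :
  is_hecke_module q M -> calibrated M -> irreducible M ->
  is_hecke_module q N -> calibrated N -> irreducible N ->
  weight_vector t (u 1%g) -> tau_orbit q t u -> u 1%g != 0 ->
  weight_vector t (u' 1%g) -> tau_orbit q t u' -> u' 1%g != 0 ->
  forall w, (u w == 0) = (u' w == 0).
Proof.
move=> hM cM iM hN cN iN tu hu u1 tu' hu' u1'.
elim/ascent_ind => [|w i asc IH]; first by rewrite (negPf u1) (negPf u1').
have := orbit_ascent_neq0 hM cM iM tu hu asc.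
have := orbit_ascent_neq0 hN cN iN tu' hu' asc.
by rewrite IH => <- /(congr1 negb); rewrite !negbK.
Qed.

(** The nonzero u w have distinct weights, hence are independent, so their images may be prescribed
    freely. *)
Lemma orbit_hom M (V : vectType C) t (u : 'S_n -> M) (u' : 'S_n -> V) :
  is_hecke_module q M -> calibrated M ->
  weight_vector t (u 1%g) -> tau_orbit q t u ->
  (forall w, u w = 0 -> u' w = 0) ->
  exists f : 'Hom(M, V), forall w, f (u w) = u' w.
Proof.
move=> hM cM tu hu u0; pose P := [pred w | u w != 0].
pose X := [tuple u (enum_val i) | i < #|P|].
pose Y := [tuple u' (enum_val i) | i < #|P|].
have freeX : free X.
  apply/freeP => k sk i.
  pose y (l : 'I_#|P|) : M := k l *: u (enum_val l).
  suff /(_ i isT) : forall l, l \in predT -> y l \in 0%VS.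
    by rewrite memv0 scaler_eq0 (negPf (enum_valP i)) orbF => /eqP.
  apply: (@weight_sum_mem _ _ M 0 _ predT (fun l => t \o (enum_val l : 'S_n))).
  - by move=> j; rewrite limg0 subvv.
  - move=> l _ j; rewrite lfunZ (orbit_weight q0 q4 hM cM tu hu).
    by rewrite !scalerA mulrC.
  - have kP (l : 'I_#|P|) := orbit_order q0 q4 hM cM tu hu (enum_valP l).
    move=> l l' _ _ e; apply: enum_val_inj.
    exact: keeps_order_inj (kP l) (kP l') e.
  - suff -> : \sum_(l in predT) y l = 0 by exact: mem0v.
    apply: etrans sk; by apply: eq_big => // l _; rewrite -tnth_nth tnth_mktuple.
have [f hf] := linear_of_free X Y.
have {}hf := hf freeX; rewrite !size_tuple in hf; have {}hf := hf erefl.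
exists (linfun f) => w; rewrite lfunE /=.
have [uw|uw] := eqVneq (u w) 0; first by rewrite uw u0 // linear0.
pose k := enum_rank_in (uw : w \in P) w.
have wk : w = enum_val k by rewrite enum_rankK_in.
have XY : tnth X k = u w by rewrite tnth_mktuple -wk.
rewrite -XY (tnth_nth 0) -(nth_map _ 0) ?size_tuple // hf.
by rewrite -tnth_nth tnth_mktuple -wk.
Qed.

Lemma irreducible_weight_iso M N t (v : M) (v' : N) :
  is_hecke_module q M -> calibrated M -> irreducible M ->
  is_hecke_module q N -> calibrated N -> irreducible N ->
  weight_vector t v -> v != 0 -> weight_vector t v' -> v' != 0 ->
  isomorphic M N.
Proof.
move=> hM cM iM hN cN iN tv v0 tv' v'0.
have [u hu u1] := tau_orbit_ex q0 q4 hM cM tv.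
have [u' hu' u1'] := tau_orbit_ex q0 q4 hN cN tv'.
rewrite -u1 in tv v0; rewrite -u1' in tv' v'0.
have uu' := orbit_neq0_eq hM cM iM hN cN iN tv hu v0 tv' hu' v'0.
have [f hf] : exists f : 'Hom(M, N), forall w, f (u w) = u' w.
  by apply: (orbit_hom hM cM tv hu) => w /eqP; rewrite uu' => /eqP.
have [g hg] : exists g : 'Hom(N, M), forall w, g (u' w) = u w.
  by apply: (orbit_hom hN cN tv' hu') => w /eqP; rewrite -uu' => /eqP.
have gf : (g \o f)%VF = \1%VF.
  apply: (orbit_linear_ext q0 q4 hM cM tv hu v0 iM) => w.
  by rewrite comp_lfunE hf hg id_lfunE.
have fg : (f \o g)%VF = \1%VF.
  apply: (orbit_linear_ext q0 q4 hN cN tv' hu' v'0 iN) => w.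
  by rewrite comp_lfunE hg hf id_lfunE.
have gfE x : g (f x) = x by rewrite -comp_lfunE gf id_lfunE.
have fgE x : f (g x) = x by rewrite -comp_lfunE fg id_lfunE.
exists f; split; [|split; [|split]].
- by apply/eqP/lker0P; exact: can_inj gfE.
- apply/eqP; rewrite eqEsubv subvf /=; apply/subvP => x _.
  by rewrite -(fgE x) memv_img ?memvf.
- move=> i x; rewrite -!comp_lfunE; congr (fun_of_lfun _ x).
  apply: (orbit_linear_ext q0 q4 hM cM tv hu v0 iM) => w.
  rewrite !comp_lfunE hf (orbit_T q0 q4 hM cM tv hu) (orbit_T q0 q4 hN cN tv' hu').
  by rewrite linearD /= !lfunZ !hf.
- move=> j x; rewrite -!comp_lfunE; congr (fun_of_lfun _ x).
  apply: (orbit_linear_ext q0 q4 hM cM tv hu v0 iM) => w.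
  rewrite !comp_lfunE hf (orbit_weight q0 q4 hM cM tv hu).
  by rewrite lfunZ hf (orbit_weight q0 q4 hN cN tv' hu').
Qed.

End Uniqueness.

(** * Standard fillings of skew shapes *)

Lemma partition_nth_le la r r' : is_partition la -> (r <= r')%N ->
  (nth 0 la r' <= nth 0 la r)%N.
Proof.
case/andP=> srt _ rr; have [lr|lr] := leqP (size la) r'.
  by rewrite nth_default.
have tr : transitive geq by move=> a b c /= ba cb; exact: leq_trans cb ba.
apply: (sorted_leq_nth tr leqnn 0%N srt _ _ _ _ rr); rewrite inE //.
exact: leq_ltn_trans lr.
Qed.

Section SkewShape.
Variables la mu : seq nat.
Hypotheses (hla : is_partition la) (hmu : is_partition mu).
Implicit Types b : box la mu.

Lemma box_bounds b : (nth 0 mu (row b) <= col b < nth 0 la (row b))%N.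
Proof. exact: (valP b). Qed.

Lemma box_ex r c : (nth 0 mu r <= c)%N -> (c < nth 0 la r)%N ->
  exists b, row b = r /\ col b = c.
Proof.
move=> h1 h2.
have rs : (r < size la)%N.
  by rewrite ltnNge; apply/negP => /(nth_default 0%N) e; rewrite e in h2.
have ch : (c < head 0 la)%N.
  by rewrite -nth0; apply: leq_trans h2 _; exact: partition_nth_le.
have h : (nth 0 mu (Ordinal rs) <= Ordinal ch)%N && (Ordinal ch < nth 0 la (Ordinal rs))%N.
  by rewrite /= h1.
by exists (Sub (Ordinal rs, Ordinal ch) h).
Qed.

Lemma box_ext b b' : row b = row b' -> col b = col b' -> b = b'.
Proof.
move=> hr hc; apply: val_inj; move: hr hc; rewrite /row /col.
case: (val b) (val b') => x y [x' y'] /=.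
by move=> /val_inj -> /val_inj ->.
Qed.

(** Convexity of skew shapes: with two boxes, one weakly southeast of the other, the whole rectangle
    they span belongs to the shape. *)
Lemma box_between b b' r c : (row b <= r <= row b')%N ->
  (col b <= c <= col b')%N -> exists b'', row b'' = r /\ col b'' = c.
Proof.
move=> /andP[r1 r2] /andP[c1 c2].
have /andP[b1 _] := box_bounds b; have /andP[_ b2] := box_bounds b'.
apply: box_ex.
  exact: leq_trans (partition_nth_le hmu r1) (leq_trans b1 c1).
exact: leq_ltn_trans c2 (leq_trans b2 (partition_nth_le hla r2)).
Qed.

Lemma diag_succ_cmp b b' : diag b' = diag b + 1 ->
  ((row b <= row b')%N /\ (col b < col b')%N) \/
  ((row b' < row b)%N /\ (col b' <= col b)%N).
Proof.
by rewrite /diag => e; have [h|h] := leqP (row b) (row b'); [left|right]; lia.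
Qed.

Section Standard.
Variables (n : nat) (L : {ffun 'I_n -> box la mu}).
Hypothesis sL : standard L.
Implicit Types i j : 'I_n.

Lemma standard_inj : injective L.
Proof. by case/and4P: sL => /injectiveP. Qed.

Lemma standard_onto b : exists i, L i = b.
Proof. by case/and4P: sL => _ /forallP/(_ b)/codomP[i ->]; exists i. Qed.

Lemma standard_row i j : row (L i) = row (L j) -> (col (L i) < col (L j))%N ->
  (i < j)%N.
Proof.
move=> e h; case/and4P: sL => _ _ /forallP/(_ i)/forallP/(_ j)/implyP + _; apply.
by rewrite e eqxx.
Qed.

Lemma standard_col i j : col (L i) = col (L j) -> (row (L i) < row (L j))%N ->
  (i < j)%N.
Proof.
move=> e h; case/and4P: sL => _ _ _ /forallP/(_ i)/forallP/(_ j)/implyP; apply.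
by rewrite e eqxx.
Qed.

(** Go from L i along its row to the corner in the column of L j, then down; the corner exists by
    convexity. *)
Lemma standard_lt i j : (row (L i) <= row (L j))%N -> (col (L i) <= col (L j))%N ->
  L i != L j -> (i < j)%N.
Proof.
move=> hr hc ne; have [c [rc cc]] := @box_between (L i) (L j) (row (L i)) (col (L j))
  ltac:(lia) ltac:(lia).
have [k kc] := standard_onto c; rewrite -kc in rc cc.
have [er|nr] := eqVneq (row (L i)) (row (L j)).
  apply: standard_row => //; rewrite ltn_neqAle hc andbT.
  by apply: contra ne => /eqP ec; apply/eqP/box_ext.
have kj : (k < j)%N by apply: standard_col => //; lia.
have [ec|nc] := eqVneq (col (L i)) (col (L j)).
  by have -> : i = k by apply/standard_inj/box_ext => //; lia.
by apply: ltn_trans kj; apply: standard_row => //; lia.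
Qed.

(** The northeast and southwest corners of the rectangle spanned by the two boxes hold two different
    entries strictly between i and j. *)
Lemma standard_diag_eq i j : (i < j)%N -> diag (L i) = diag (L j) -> (i.+2 < j)%N.
Proof.
move=> ij dij; have rij : (row (L i) < row (L j))%N.
  rewrite ltnNge; apply/negP => h.
  have [e|ne] := eqVneq (L i) (L j); first by move/standard_inj: e ij => ->; rewrite ltnn.
  rewrite eq_sym in ne.
  have : (j < i)%N by apply: standard_lt ne => //; move: dij; rewrite /diag; lia.
  by lia.
have cij : (col (L i) < col (L j))%N by move: dij; rewrite /diag; lia.
have [c [rc cc]] := @box_between (L i) (L j) (row (L i)) (col (L j))
  ltac:(lia) ltac:(lia).
have [d [rd cd]] := @box_between (L i) (L j) (row (L j)) (col (L i))
  ltac:(lia) ltac:(lia).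
have [k kc] := standard_onto c; rewrite -kc in rc cc.
have [k' kd] := standard_onto d; rewrite -kd in rd cd.
have ik : (i < k)%N by apply: standard_row => //; lia.
have kj : (k < j)%N by apply: standard_col => //; lia.
have ik' : (i < k')%N by apply: standard_col => //; lia.
have kj' : (k' < j)%N by apply: standard_row => //; lia.
have kk : k != k' :> nat by apply: contraTneq rij => /val_inj e; move: rc; rewrite e rd; lia.
lia.
Qed.

Lemma standard_adj i j : (i < j)%N -> diag (L j) = diag (L i) + 1 ->
  (row (L i) <= row (L j))%N /\ (col (L i) < col (L j))%N.
Proof.
move=> ij /diag_succ_cmp[//|[h1 h2]].
suff : (j < i)%N by lia.
by apply: standard_lt => //; first exact: ltnW; apply/eqP => e; rewrite e ltnn in h1.
Qed.

Lemma standard_adjN i j : (i < j)%N -> diag (L i) = diag (L j) + 1 ->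
  (row (L i) < row (L j))%N /\ (col (L i) <= col (L j))%N.
Proof.
move=> ij /diag_succ_cmp[[h1 h2]|//].
suff : (j < i)%N by lia.
by apply: standard_lt => //; first exact: ltnW; apply/eqP => e; rewrite e ltnn in h2.
Qed.

End Standard.

Definition diag_adj b b' : bool := (diag b == diag b' + 1) || (diag b' == diag b + 1).

Lemma diag_adjC b b' : diag_adj b b' = diag_adj b' b.
Proof. by rewrite /diag_adj orbC. Qed.

Definition swap_filling n (i : 'I_n.-1) (L : {ffun 'I_n -> box la mu}) :
  {ffun 'I_n -> box la mu} := [ffun j => L (swap_ix i j)].

Lemma swap_fillingK n (i : 'I_n.-1) : involutive (@swap_filling n i).
Proof. by move=> L; apply/ffunP => j; rewrite !ffunE /swap_ix tpermK. Qed.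

(** Exchanging two consecutive entries can only violate a row or column condition between these two
    entries. If they share a row or a column no box fits between them, so they are neighbours and on
    adjacent diagonals. *)
Lemma standard_swap n (i : 'I_n.-1) (L : {ffun 'I_n -> box la mu}) : standard L ->
  ~~ diag_adj (L (fst_ix i)) (L (snd_ix i)) -> standard (swap_filling i L).
Proof.
move=> sL nadj; have injL := standard_inj sL.
have swap_lt (x y : 'I_n) : (swap_ix i x < swap_ix i y)%N ->
    (x < y)%N \/ (swap_ix i x = fst_ix i /\ swap_ix i y = snd_ix i).
  rewrite /swap_ix; case: (tpermP (fst_ix i) (snd_ix i) x) => [->|->|/eqP x1 /eqP x2];
    case: (tpermP (fst_ix i) (snd_ix i) y) => [->|->|/eqP y1 /eqP y2] //=; try (by right);
    try (move: x1 x2; rewrite -!val_eqE /= => x1 x2);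
    try (move: y1 y2; rewrite -!val_eqE /= => y1 y2); move=> h; left; lia.
apply/and4P; split.
- by apply/injectiveP => x y; rewrite !ffunE => /injL/perm_inj.
- apply/forallP => b; have [j <-] := standard_onto sL b.
  by apply/codomP; exists (swap_ix i j); rewrite ffunE /swap_ix tpermK.
- apply/forallP => x; apply/forallP => y; apply/implyP; rewrite !ffunE.
  move=> /andP[/eqP hr hc]; have lt := standard_row sL hr hc.
  case: (swap_lt _ _ lt) => // -[ex ey]; rewrite ex ey in hr hc lt.
  case/negP: nadj; rewrite /diag_adj; apply/orP; right.
  have [h|h] := leqP (col (L (snd_ix i))) (col (L (fst_ix i))).+1.
    by rewrite /diag; lia.
  have [c [rc cc]] := @box_between (L (fst_ix i)) (L (snd_ix i)) (row (L (fst_ix i)))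
    (col (L (fst_ix i))).+1 ltac:(lia) ltac:(lia).
  have [k kc] := standard_onto sL c; rewrite -kc in rc cc.
  have := @standard_row _ _ sL (fst_ix i) k ltac:(lia) ltac:(lia).
  have := @standard_row _ _ sL k (snd_ix i) ltac:(lia) ltac:(lia).
  by rewrite /=; lia.
- apply/forallP => x; apply/forallP => y; apply/implyP; rewrite !ffunE.
  move=> /andP[/eqP hr hc]; have lt := standard_col sL hr hc.
  case: (swap_lt _ _ lt) => // -[ex ey]; rewrite ex ey in hr hc lt.
  case/negP: nadj; rewrite /diag_adj; apply/orP; left.
  have [h|h] := leqP (row (L (snd_ix i))) (row (L (fst_ix i))).+1.
    by rewrite /diag; lia.
  have [c [rc cc]] := @box_between (L (fst_ix i)) (L (snd_ix i)) (row (L (fst_ix i))).+1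
    (col (L (fst_ix i))) ltac:(lia) ltac:(lia).
  have [k kc] := standard_onto sL c; rewrite -kc in rc cc.
  have := @standard_col _ _ sL (fst_ix i) k ltac:(lia) ltac:(lia).
  have := @standard_col _ _ sL k (snd_ix i) ltac:(lia) ltac:(lia).
  by rewrite /=; lia.
Qed.

(** On adjacent diagonals the box of i lies weakly northwest of the box of i + 1, whether or not the
    boxes touch; after the swap [standard_lt] fails. *)
Lemma standard_swapN n (i : 'I_n.-1) (L : {ffun 'I_n -> box la mu}) : standard L ->
  diag_adj (L (fst_ix i)) (L (snd_ix i)) -> ~~ standard (swap_filling i L).
Proof.
move=> sL adj; apply/negP => sL'.
have lt : (fst_ix i < snd_ix i)%N by rewrite /=.
have ne : L (snd_ix i) != L (fst_ix i).
  by rewrite (inj_eq (standard_inj sL)) eq_sym fst_neq_snd.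
suff /andP[h1 h2] : (row (L (fst_ix i)) <= row (L (snd_ix i)))%N &&
                   (col (L (fst_ix i)) <= col (L (snd_ix i)))%N.
  have := @standard_lt _ _ sL' (snd_ix i) (fst_ix i).
  rewrite !ffunE swap_ixL swap_ixR eq_sym => /(_ h1 h2 ne) /=; lia.
case/orP: adj => /eqP.
  by move/(standard_adjN sL lt) => [h1 h2]; rewrite h2 andbT ltnW.
by move/(standard_adj sL lt) => [h1 h2]; rewrite h1 ltnW.
Qed.

Lemma standard_adj_diag n (i : 'I_n.-1) (L : {ffun 'I_n -> box la mu}) :
  standard L -> diag (L (fst_ix i)) != diag (L (snd_ix i)).
Proof.
move=> sL; apply/eqP => e; have lt : (fst_ix i < snd_ix i)%N by rewrite /=.
by have := standard_diag_eq sL lt e; rewrite /=; lia.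
Qed.

(** At the first entry placed differently both boxes lie on one diagonal. The upper box is filled in
    the other tableau by a smaller entry, where the two tableaux agree, contradicting
    injectivity. *)
Lemma standard_unique n (L L' : {ffun 'I_n -> box la mu}) :
  standard L -> standard L' -> (forall j, diag (L j) = diag (L' j)) -> L = L'.
Proof.
move=> sL sL' e; apply/ffunP => -[j jn].
have [m] := ubnP j; elim: m => // m IH in j jn *; rewrite ltnS => jm.
have aux (x y : {ffun 'I_n -> box la mu}) : standard x -> standard y ->
    diag (x (Ordinal jn)) = diag (y (Ordinal jn)) ->
    (forall k (kn : (k < n)%N), (k < m)%N -> x (Ordinal kn) = y (Ordinal kn)) ->
    (row (x (Ordinal jn)) < row (y (Ordinal jn)))%N -> False.
  move=> sx sy dxy xy lt.
  have [k yk] := standard_onto sy (x (Ordinal jn)).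
  have : (k < Ordinal jn)%N.
    apply: (standard_lt sy); rewrite yk ?(ltnW lt) //.
      by move: dxy lt; rewrite /diag; lia.
    by apply: contraTneq lt => ->; rewrite ltnn.
  case: k yk => k kn yk /= kj; move: yk; rewrite -xy; last by lia.
  by move=> /(standard_inj sx) [ke]; lia.
have IH' k (kn : (k < n)%N) : (k < m)%N -> L (Ordinal kn) = L' (Ordinal kn) by exact: IH.
have dj := e (Ordinal jn).
have [lt|lt|re] := ltngtP (row (L (Ordinal jn))) (row (L' (Ordinal jn))).
- by case: (aux L L' sL sL' dj IH' lt).
- by case: (aux L' L sL' sL (esym dj) (fun k kn km => esym (IH' k kn km)) lt).
- by apply: box_ext => //; move: dj; rewrite /diag re => /addIr[].
Qed.

Lemma standard_ex : exists L : {ffun 'I_#|box la mu| -> box la mu}, standard L.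
Proof.
(* Boxes are read row by row: W exceeds every column index, so [key] encodes the lexicographic
   order, and the successor keeps W positive for the divisions. *)
pose W := (head 0 la).+1.
pose key b := (row b * W + col b)%N.
have colW b : (col b < W)%N by rewrite /W ltnS ltnW // /col.
have keyr b b' : key b = key b' -> b = b'.
  move=> e; have h := congr1 (divn^~ W) e; have h' := congr1 (modn^~ W) e.
  move: h h'; rewrite /key /= !divnMDl // !divn_small // !addn0 => h.
  by rewrite !modnMDl !modn_small // => h'; exact: box_ext.
pose s := sort (relpre key leq) (enum (box la mu)).
have tot : total (relpre key leq) by move=> x y; exact: leq_total.
have tr : transitive (relpre key leq) by move=> x y z; exact: leq_trans.
have srt : sorted (relpre key leq) s by exact: sort_sorted.
have us : uniq s by rewrite sort_uniq enum_uniq.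
have ss : size s = #|box la mu| by rewrite size_sort -cardE.
have st : size s == #|box la mu| by rewrite ss.
pose L := [ffun i : 'I_#|box la mu| => tnth (Tuple st) i].
have lt i j : (key (L i) < key (L j))%N -> (i < j)%N.
  apply: contraTT; rewrite -!leqNgt => ji; rewrite !ffunE.
  have b0 := L i; rewrite !(tnth_nth b0) /=.
  by apply: (sorted_leq_nth tr _ b0 srt); rewrite ?inE ?ss //= => x; exact: leqnn.
exists L; apply/and4P; split.
- apply/injectiveP => i j; rewrite !ffunE => e.
  have b0 := L i; move: e; rewrite !(tnth_nth b0) /= => /eqP.
  by rewrite nth_uniq ?ss // => /eqP/val_inj.
- apply/forallP => b; have /(nthP b)[k ks kb] : b \in s by rewrite mem_sort mem_enum.
  rewrite ss in ks; apply/codomP; exists (Ordinal ks).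
  by rewrite ffunE (tnth_nth b) /= kb.
- apply/forallP => i; apply/forallP => j; apply/implyP => /andP[/eqP e h].
  by apply: lt; rewrite /key e ltn_add2l.
- apply/forallP => i; apply/forallP => j; apply/implyP => /andP[/eqP e h].
  by apply: lt; rewrite /key e ltn_add2r ltn_mul2r.
Qed.

End SkewShape.

(** * Adjacency of boxes recovered from the diagonals of the entries *)

Section SameDiagonals.
Variables la mu la' mu' : seq nat.
Hypotheses (hla : is_partition la) (hmu : is_partition mu).
Hypotheses (hla' : is_partition la') (hmu' : is_partition mu').
Variables (n : nat) (L : {ffun 'I_n -> box la mu}) (L' : {ffun 'I_n -> box la' mu'}).
Hypotheses (sL : standard L) (sL' : standard L').
Hypothesis diag_eq : forall j k, diag (L' j) = diag (L' k) -> diag (L j) = diag (L k).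
Hypothesis diag_succ :
  forall j k, diag (L j) = diag (L k) + 1 -> diag (L' j) = diag (L' k) + 1.

(** A later entry m on the diagonal of L j lies at least one row and one column beyond L j, hence
    weakly southeast of L k, and so comes after k. *)
Lemma no_diag_between (j k m : 'I_n) : (j < m < k)%N ->
  (row (L k) <= (row (L j)).+1)%N -> (col (L k) <= (col (L j)).+1)%N ->
  ((row (L j)).+1 != row (L k)) || ((col (L j)).+1 != col (L k)) ->
  diag (L m) = diag (L j) -> False.
Proof.
move=> /andP[jm mk] rk ck ne dm.
have rjm : (row (L j) < row (L m))%N.
  rewrite ltnNge; apply/negP => h.
  have cjm : (col (L m) <= col (L j))%N by move: dm; rewrite /diag; lia.
  have mj : L m != L j by rewrite (inj_eq (standard_inj sL)) -val_eqE /=; lia.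
  by have := standard_lt hla hmu sL h cjm mj; lia.
have cjm : (col (L j) < col (L m))%N by move: dm rjm; rewrite /diag; lia.
have rkm : (row (L k) <= row (L m))%N by exact: leq_trans rk rjm.
have ckm : (col (L k) <= col (L m))%N by exact: leq_trans ck cjm.
have km : L k != L m by rewrite (inj_eq (standard_inj sL)) -val_eqE /=; lia.
by have := standard_lt hla hmu sL rkm ckm km; lia.
Qed.

Lemma diag_next_box (j k : 'I_n) : (row (L' j) < row (L' k))%N ->
  (col (L' j) < col (L' k))%N ->
  ((row (L' j)).+1 != row (L' k)) || ((col (L' j)).+1 != col (L' k)) ->
  exists2 m : 'I_n, (j < m < k)%N & diag (L' m) = diag (L' j).
Proof.
move=> hr hc ne.
have [c [rc cc]] := @box_between _ _ hla' hmu' (L' j) (L' k) (row (L' j)).+1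
  (col (L' j)).+1 ltac:(lia) ltac:(lia).
have [m mc] := standard_onto sL' c; rewrite -mc in rc cc.
exists m; last by rewrite /diag rc cc; lia.
apply/andP; split; apply: (standard_lt hla' hmu' sL'); rewrite ?rc ?cc //.
  by apply/eqP => e; move: rc; rewrite e; lia.
by apply: contraTN ne => /eqP e; rewrite negb_or !negbK -rc -cc e !eqxx.
Qed.

(** In L' the boxes lie on consecutive diagonals with j < k. If they did not touch, the next box on
    the diagonal of L' j would hold an entry between j and k ([diag_next_box]), which
    [no_diag_between] forbids in L. *)
Lemma transfer_right (j k : 'I_n) :
  row (L j) = row (L k) -> col (L k) = (col (L j)).+1 ->
  row (L' j) = row (L' k) /\ col (L' k) = (col (L' j)).+1.
Proof.
move=> er ec; have jk : (j < k)%N by apply: (standard_row sL) => //; rewrite ec.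
have d' : diag (L' k) = diag (L' j) + 1 by apply: diag_succ; rewrite /diag er ec; lia.
have [hr hc] := standard_adj hla' hmu' sL' jk d'.
have [e|ne] := eqVneq (row (L' j)) (row (L' k)).
  by split=> //; move: d'; rewrite /diag e; lia.
have hr' : (row (L' j) < row (L' k))%N by rewrite ltn_neqAle ne.
have ne' : ((row (L' j)).+1 != row (L' k)) || ((col (L' j)).+1 != col (L' k)).
  by move: d' ne; rewrite /diag; lia.
have [m jmk /diag_eq dm] := diag_next_box hr' hc ne'.
by case: (no_diag_between jmk _ _ _ dm); rewrite ?er ?ec //; lia.
Qed.

Lemma transfer_down (j k : 'I_n) :
  col (L j) = col (L k) -> row (L k) = (row (L j)).+1 ->
  col (L' j) = col (L' k) /\ row (L' k) = (row (L' j)).+1.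
Proof.
move=> ec er; have jk : (j < k)%N by apply: (standard_col sL) => //; rewrite er.
have d' : diag (L' j) = diag (L' k) + 1 by apply: diag_succ; rewrite /diag er ec; lia.
have [hr hc] := standard_adjN hla' hmu' sL' jk d'.
have [e|ne] := eqVneq (col (L' j)) (col (L' k)).
  by split=> //; move: d'; rewrite /diag e; lia.
have hc' : (col (L' j) < col (L' k))%N by rewrite ltn_neqAle ne.
have ne' : ((row (L' j)).+1 != row (L' k)) || ((col (L' j)).+1 != col (L' k)).
  by move: d' ne; rewrite /diag; lia.
have [m jmk /diag_eq dm] := diag_next_box hr hc' ne'.
by case: (no_diag_between jmk _ _ _ dm); rewrite ?er ?ec //; lia.
Qed.

End SameDiagonals.

(** * The modules attached to placed skew shapes *)

Lemma cexpD (R : realType) (z w : R[i]) : cexp (z + w) = cexp z * cexp w.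
Proof.
case: z w => [a b] [c d]; rewrite /cexp /= expRD cosD sinD.
by simpc; congr Complex; ring.
Qed.

Lemma cexp0 (R : realType) : cexp (0 : R[i]) = 1.
Proof. by rewrite /cexp /= expR0 cos0 sin0 mul1r. Qed.

Lemma cexp_neq0 (R : realType) (z : R[i]) : cexp z != 0.
Proof.
apply/negP => /eqP z0; have := oner_neq0 (R[i] : fieldType).
by rewrite -(cexp0 R) -[in X in X != _](subrr z) cexpD z0 mul0r eqxx.
Qed.

Lemma calibrated_of_basis (R : realType) n (M : hecke_data R n) (X : seq M) :
  basis_of {:M} X ->
  (forall x j, x \in X -> exists a : R[i], opX M j x = a *: x) -> calibrated M.
Proof.
move=> bX hX; have szX : size X == \dim {:M}.
  by rewrite eq_sym -(size_basis (X := in_tuple X) bX).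
exists (Tuple szX); split=> // k j; apply: hX; exact: mem_tnth.
Qed.

(** Cayley-Hamilton for a 2 by 2 matrix of trace z and determinant x x' - a a' = -1; nothing
    requires v and vf to be independent, so vf may be 0. *)
Lemma square_on_edge (K : fieldType) (V : vectType K) (f : 'End(V))
    (v vf : V) (z x x' a a' : K) :
  f v = x *: v + a *: vf -> f vf = x' *: vf + a' *: v ->
  x + x' = z -> a * a' = 1 + x * x' -> f (f v) = z *: f v + v.
Proof.
move=> fv fvf <- aa; rewrite fv lfunD !lfunZ fv fvf.
apply: scalar_ext => h; rewrite !(linearD, scalarZ) /=.
apply/eqP; rewrite -subr_eq0; apply/eqP.
transitivity ((a * a' - (1 + x * x')) * h v); first by ring.
by rewrite aa subrr mul0r.
Qed.

Lemma comm_on_square (K : fieldType) (V : vectType K) (f g : 'End(V))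
    (v vf vg vfg : V) (x y a b : K) :
  f v = x *: v + a *: vf -> g v = y *: v + b *: vg ->
  f vg = x *: vg + a *: vfg -> g vf = y *: vf + b *: vfg ->
  f (g v) = g (f v).
Proof.
by move=> fv gv fvg gvf; rewrite fv gv !lfunD !lfunZ fv gv fvg gvf; lmod_ring.
Qed.

(* With s and r the simple reflections of S_3, the vectors v, vf, vg, vgf, vfg
   and vl are indexed by 1, s, r, rs, sr and srs. *)
Lemma braid_on_hexagon (K : fieldType) (V : vectType K) (f g : 'End(V))
    (v vf vg vgf vfg vl : V) (z x y w x' w' a b c a' c' : K) :
  f v = x *: v + a *: vf -> g v = w *: v + c *: vg ->
  f vf = x' *: vf + a' *: v -> g vf = y *: vf + b *: vgf ->
  g vg = w' *: vg + c' *: v -> f vg = y *: vg + b *: vfg ->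
  f vgf = w *: vgf + c *: vl -> g vfg = x *: vfg + a *: vl ->
  x + x' = z -> w + w' = z -> y * (x + w - z) = x * w ->
  a * a' = 1 + x * x' -> c * c' = 1 + w * w' ->
  f (g (f v)) = g (f (g v)).
Proof.
move=> fv gv fvf gvf gvg fvg fvgf gvfg xz wz yz aa cc.
rewrite fv gv !linearD /= !lfunZ gv gvf fv fvg !linearD /= !lfunZ.
rewrite fv fvf fvg fvgf gv gvf gvg gvfg.
have {}xz : x' = z - x by rewrite -xz addrC addKr.
have {}wz : w' = z - w by rewrite -wz addrC addKr.
rewrite xz wz in aa cc *.
apply: scalar_ext => h; rewrite !(linearD, scalarZ) /=.
apply/eqP; rewrite -subr_eq0; apply/eqP.
(* A combination of the defect of the three-term identity and of the defects of the two quadratic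
   relations. *)
transitivity ((y * (x + w - z) - x * w) *
    (c * h vg - a * h vf - (x - w) * h v) +
  y * h v * ((a * a' - (1 + x * (z - x))) - (c * c' - (1 + w * (z - w))))).
  by ring.
by rewrite yz aa cc !subrr mul0r mulr0 addr0.
Qed.

Section ContentRange.
Variables (R : realType) (q l : R[i]) (D : set R[i]).
Local Notation C := R[i].
Hypothesis hD : content_range q l D.

Lemma q2pow_neq0 x : q2pow l x != 0. Proof. exact: cexp_neq0. Qed.

Lemma q2powD x y : q2pow l (x + y) = q2pow l x * q2pow l y.
Proof. by rewrite /q2pow mulrDr cexpD. Qed.

Lemma q2powB x y : q2pow l (x - y) = q2pow l x / q2pow l y.
Proof.
by apply: (mulIf (q2pow_neq0 y)); rewrite -q2powD subrK divfK ?q2pow_neq0.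
Qed.

Lemma q2pow1 : q2pow l 1 = q ^+ 2.
Proof. by case: hD => <- _; rewrite /q2pow mulr1. Qed.

Lemma q2pow_inj x y : D x -> D y -> q2pow l x = q2pow l y -> x = y.
Proof. by case: hD => _ [_ [_ inj _]] Dx Dy; apply: inj; rewrite inE. Qed.

Lemma range_shift x (m : int) : D x -> D (x + m%:~R).
Proof. by case: hD => _ [h _]; exact: h. Qed.

Lemma q2pow_succ x y : D x -> D y ->
  (q2pow l y = q ^+ 2 * q2pow l x) <-> y = x + 1.
Proof.
move=> Dx Dy; rewrite -q2pow1 mulrC -q2powD; split=> [|-> //].
by apply: q2pow_inj => //; exact: (range_shift 1 Dx).
Qed.

Lemma q2pow_onto (z : C) : z != 0 -> exists2 x, D x & q2pow l x = z.
Proof. by case: hD => _ [_ [_ _ h]] z0; have [x Dx xz] := h z z0; exists x. Qed.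

End ContentRange.

Section ShapeModuleTheory.
Variables (R : realType) (n : nat) (q l : R[i]) (D : set R[i]).
Local Notation C := R[i].
Hypotheses (q0 : q != 0) (hD : content_range q l D).
Variable p : placed_skew_shape D n.

Local Notation la := (outer p).
Local Notation mu := (inner p).
Local Notation hla := (outer_partition p).
Local Notation hmu := (inner_partition p).
Local Notation T := (shape_T q l p).
Local Notation X := (shape_X l p).
Local Notation V := (shape_module q l p).
Implicit Types (L N : filling p) (i : 'I_n.-1) (j : 'I_n) (b : box la mu).

Definition box_weight b : C := q2pow l (content b).

Lemma box_weight_neq0 b : box_weight b != 0. Proof. exact: q2pow_neq0. Qed.

Lemma box_weight_eq b b' : (box_weight b == box_weight b') = (diag b == diag b').
Proof.
apply/eqP/eqP => [|/content_eq e]; last by rewrite /box_weight e.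
by move/(q2pow_inj hD (content_in b) (content_in b'))/content_eq.
Qed.

Lemma box_weight_succ b b' :
  (box_weight b' == q ^+ 2 * box_weight b) = (diag b' == diag b + 1).
Proof.
apply/eqP/eqP => [/(q2pow_succ hD (content_in b) (content_in b'))/content_adj //|].
by move=> e; apply/(q2pow_succ hD (content_in b) (content_in b'))/content_adj.
Qed.

Lemma kappa_box b b' : diag b != diag b' ->
  (kappa q (box_weight b) (box_weight b') == 0) = diag_adj b b'.
Proof.
move=> nd; rewrite kappa_eq0 ?box_weight_neq0 ?box_weight_eq //.
by rewrite !box_weight_succ.
Qed.

(** On adjacent diagonals q^-1 + [tcoef] vanishes in one of the two directions. It is set to 0 in
    both, which does no harm on a standard filling because its swap is then nonstandard. *)
Definition swap_coef b b' : C :=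
  if diag_adj b b' then 0 else q^-1 + tcoef q (box_weight b) (box_weight b').

Lemma swap_coef_mul b b' : diag b != diag b' ->
  swap_coef b b' * swap_coef b' b = kappa q (box_weight b) (box_weight b').
Proof.
move=> nd; rewrite /swap_coef [diag_adj b' b]diag_adjC.
case: ifP => adj; first by apply/esym/eqP; rewrite mulr0 kappa_box.
by rewrite -kappaE ?box_weight_neq0 ?box_weight_eq.
Qed.

Lemma swap_coef_neq0 b b' : diag b != diag b' -> ~~ diag_adj b b' ->
  swap_coef b b' != 0.
Proof.
move=> nd nadj; rewrite /swap_coef (negPf nadj).
rewrite tcoef_eq ?box_weight_neq0 ?box_weight_eq // box_weight_succ.
by apply: contra nadj; rewrite /diag_adj => ->.
Qed.

Lemma swap_entries_out i j L : swap_entries i L j = L (swap_ix i j).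
Proof. by rewrite ffunE. Qed.

(* Nonstandard fillings give zero vectors, and swap_coef vanishes on every swap
   between a standard and a nonstandard filling, so the formulas for the action
   hold uniformly for all fillings. *)
Lemma shape_TE i N :
  T i (tab_vec N) = tcoef q (box_weight (N (fst_ix i))) (box_weight (N (snd_ix i))) *:
      tab_vec N +
    swap_coef (N (fst_ix i)) (N (snd_ix i)) *: tab_vec (swap_entries i N).
Proof.
have [sN|nN] := boolP (standard N).
  rewrite -[N]/(val (Sub N sN : tableau p)) shape_T_tab_vec /= /diag_coef q2powB.
  congr (_ + _); rewrite /swap_coef; case: ifP => // adj.
  by rewrite (tab_vec_nonstandard (standard_swapN hla hmu sN adj)) !scaler0.
rewrite (tab_vec_nonstandard nN) linear0 scaler0 add0r.
rewrite /swap_coef; case: ifP => [|/negbT nadj]; first by rewrite scale0r.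
rewrite tab_vec_nonstandard ?scaler0 //.
apply: contra nN => sN'; rewrite -(swap_fillingK i N).
apply: (standard_swap hla hmu sN').
by rewrite !ffunE swap_ixL swap_ixR diag_adjC.
Qed.

Lemma shape_XE j N : X j (tab_vec N) = box_weight (N j) *: tab_vec N.
Proof.
have [sN|nN] := boolP (standard N).
  by rewrite -[N]/(val (Sub N sN : tableau p)) shape_X_tab_vec.
by rewrite (tab_vec_nonstandard nN) linear0 scaler0.
Qed.

Lemma tab_vec_weight N : weight_vector (M := V) (fun j => box_weight (N j)) (tab_vec N).
Proof. by move=> j; exact: shape_XE. Qed.

Lemma tab_vec_sum (y : shape_space p) : y = \sum_L y L *: tab_vec (val L).
Proof.
have E (L L' : tableau p) : (y L' *: tab_vec (val L')) L = y L' * (L == L')%:R.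
  transitivity (y L' *: tab_vec (val L') L); first exact: ffunE.
  by rewrite /tab_vec ffunE val_eqE.
apply/ffunP => L; rewrite sum_ffunE (bigD1 L) // big1 => [|L' nL].
  by rewrite E eqxx mulr1 /= addr0.
by apply: (etrans (E _ _)); rewrite eq_sym (negPf nL) mulr0.
Qed.

Lemma tab_vec_lfun_ext (W : vectType C) (f g : 'Hom(shape_space p, W)) :
  (forall L : tableau p, f (tab_vec (val L)) = g (tab_vec (val L))) -> f = g.
Proof.
move=> fg; apply/lfunP => y; rewrite (tab_vec_sum y) !linear_sum.
by apply: eq_bigr => L _; rewrite !linearZ /= fg.
Qed.

Lemma shape_commT i i' : (i.+1 < i')%N -> (T i \o T i' = T i' \o T i)%VF.
Proof.
move=> ii; move: (shape_TE i) (shape_TE i'); move: (T i) (T i') => f g fE gE.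
apply: tab_vec_lfun_ext => L; set N := val L; rewrite !comp_lfunE.
have E : swap_entries i (swap_entries i' N) = swap_entries i' (swap_entries i N).
  by apply/ffunP => j; rewrite !swap_entries_out -!permM swap_comm.
apply: (comm_on_square (fE N) (gE N)).
- by rewrite fE !swap_entries_out !swap_ixD //=; lia.
- by rewrite gE E !swap_entries_out !swap_ixD //=; lia.
Qed.

Lemma shape_mulT i : (T i \o T i = (q - q^-1) *: T i + \1)%VF.
Proof.
move: (shape_TE i); move: (T i) => f fE.
apply: tab_vec_lfun_ext => L; set N := val L.
have nd := standard_adj_diag hla hmu i (valP L); rewrite -/N in nd.
rewrite add_lfunE scale_lfunE id_lfunE comp_lfunE.
have fN := fE (swap_entries i N).
rewrite !swap_entries_out swap_ixL swap_ixR in fN.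
rewrite (swap_fillingK i N : swap_entries i (swap_entries i N) = N) in fN.
apply: (square_on_edge (fE N) fN); last exact: swap_coef_mul.
by apply: tcoef_add; rewrite ?box_weight_neq0 ?box_weight_eq.
Qed.

Lemma shape_braid i i' : i' = i.+1 :> nat ->
  (T i \o T i' \o T i = T i' \o T i \o T i')%VF.
Proof.
move=> ii; have e := snd_fst_ix ii.
move: (shape_TE i) (shape_TE i'); move: (T i) (T i') => f g T1 T2.
apply: tab_vec_lfun_ext => L; set N := val L; rewrite !comp_lfunE.
have sN : standard N := valP L.
set pp := fst_ix i; set ss := snd_ix i; set rr := snd_ix i'.
have ab : diag (N pp) != diag (N ss) by exact: (standard_adj_diag hla hmu _ sN).
have bc : diag (N ss) != diag (N rr) by rewrite /ss e; exact: (standard_adj_diag hla hmu _ sN).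
(* Entries on one diagonal are at least three apart, while these are two apart. *)
have ac : diag (N pp) != diag (N rr).
  apply/eqP => d; have lt : (pp < rr)%N by rewrite /=; lia.
  by have := standard_diag_eq hla hmu sN lt d; rewrite /=; lia.
have E3 : swap_ix i rr = rr by rewrite swap_ixD //=; lia.
have E4 : swap_ix i' pp = pp by rewrite swap_ixD //=; lia.
have E5 : swap_ix i' ss = rr by rewrite /ss e swap_ixL.
have E6 : swap_ix i' rr = ss by rewrite /ss e swap_ixR.
rewrite -/pp -/ss in T1; rewrite -e -/ss -/rr in T2.
have sw1 M : swap_entries i (swap_entries i M) = M := swap_fillingK i M.
have sw2 M : swap_entries i' (swap_entries i' M) = M := swap_fillingK i' M.
have br : swap_entries i (swap_entries i' (swap_entries i N)) =
          swap_entries i' (swap_entries i (swap_entries i' N)).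
  apply/ffunP => j; rewrite !swap_entries_out; congr (N _).
  by have := congr1 (fun s : 'S_n => s j) (swap_braid 1%g ii); rewrite !mul_swapE !perm1.
have sE := (swap_entries_out, swap_ixL, swap_ixR, E3, E4, E5, E6).
have w0 b := box_weight_neq0 b.
apply: (@braid_on_hexagon _ _ f g (tab_vec N)
  (tab_vec (swap_entries i N)) (tab_vec (swap_entries i' N))
  (tab_vec (swap_entries i' (swap_entries i N)))
  (tab_vec (swap_entries i (swap_entries i' N)))
  (tab_vec (swap_entries i (swap_entries i' (swap_entries i N)))) (q - q^-1)
  (tcoef q (box_weight (N pp)) (box_weight (N ss)))
  (tcoef q (box_weight (N pp)) (box_weight (N rr)))
  (tcoef q (box_weight (N ss)) (box_weight (N rr)))
  (tcoef q (box_weight (N ss)) (box_weight (N pp)))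
  (tcoef q (box_weight (N rr)) (box_weight (N ss)))
  (swap_coef (N pp) (N ss)) (swap_coef (N pp) (N rr)) (swap_coef (N ss) (N rr))
  (swap_coef (N ss) (N pp)) (swap_coef (N rr) (N ss))).
- by rewrite T1.
- by rewrite T2.
- by rewrite T1 !sE sw1.
- by rewrite T2 !sE.
- by rewrite T2 !sE sw2.
- by rewrite T1 !sE.
- by rewrite T1 !sE.
- by rewrite T2 !sE br.
- by apply: tcoef_add; rewrite ?w0 ?box_weight_eq.
- by apply: tcoef_add; rewrite ?w0 ?box_weight_eq.
- by apply: tcoef_mul; rewrite ?w0 ?box_weight_eq.
- exact: swap_coef_mul.
- exact: swap_coef_mul.
Qed.

End ShapeModuleTheory.

Lemma monomial_eval_swap (F : fieldType) n (x : 'I_n -> F) (i : 'I_n.-1)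
    (g : exponent n) :
  monomial_eval (x \o swap_ix i) g = monomial_eval x (swap_exp i g).
Proof.
rewrite /monomial_eval (reindex_inj (@perm_inj _ (swap_ix i))) /=.
by apply: eq_bigr => j _; rewrite ffunE /swap_ix tpermK.
Qed.

Lemma mulrz_lfunE (K : fieldType) (U W : vectType K) (f : 'Hom(U, W)) (x : U) (c : int) :
  (f *~ c) x = (c%:~R : K) *: f x.
Proof.
have fMn m : (f *+ m) x = (m%:R : K) *: f x.
  by elim: m => [|m IH]; rewrite ?scale0r ?zero_lfunE // !mulrS add_lfunE IH scalerDl scale1r.
by case: c => m; rewrite /intmul ?opp_lfunE fMn ?scaleNr.
Qed.

(** The v' terms of both sides agree, since x^g on v' and x^(s_i g) on v are the same scalar. The v
    terms leave [tcoef] times the difference of two monomials, which [divided_differenceP]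
    identifies with the divided difference. *)
Lemma opX_exp_T_weight (R : realType) n (q : R[i]) (M : hecke_data R n)
    (i : 'I_n.-1) (g : exponent n) (x : 'I_n -> R[i]) (v v' : M) (k : R[i]) :
  (forall j, lker (opX M j) == 0%VS) -> (forall j, x j != 0) ->
  x (fst_ix i) != x (snd_ix i) ->
  weight_vector x v -> weight_vector (x \o swap_ix i) v' ->
  opT M i v = tcoef q (x (fst_ix i)) (x (snd_ix i)) *: v + k *: v' ->
  (opX_exp M g \o opT M i)%VF v =
  ((opT M i \o opX_exp M (swap_exp i g))%VF +
   (q - q^-1) *: \sum_(t <- divided_difference i g) opX_exp M t.2 *~ t.1) v.
Proof.
move=> lk x0 xne xv xv' Tv.
have xd : x (snd_ix i) - x (fst_ix i) != 0 by rewrite subr_eq0 eq_sym.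
have expE h := opX_exp_weight h lk xv x0.
have expE' h := opX_exp_weight h lk xv' (fun j => x0 (swap_ix i j)).
rewrite add_lfunE scale_lfunE !comp_lfunE sum_lfunE.
rewrite (eq_bigr (fun t : int * exponent n =>
    (monomial_eval x t.2 *~ t.1) *: v)) => [|[c h] _]; last first.
  by rewrite mulrz_lfunE expE scalerA mulrzl.
rewrite -scaler_suml expE lfunZ Tv lfunD !lfunZ expE expE' monomial_eval_swap.
have := divided_differenceP i g x0; set S := \sum_(t <- _) _ => hS.
have E : (q - q^-1) * S = tcoef q (x (fst_ix i)) (x (snd_ix i)) *
      (monomial_eval x g - monomial_eval x (swap_exp i g)).
  apply: (mulfI xd); rewrite mulrCA hS tcoefE //; set z := q - q^-1; field.
  exact: xd.
rewrite [X in _ = _ + X]scalerA E; lmod_ring.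
Qed.

(** * The shape modules satisfy the relations and are calibrated and irreducible *)

Section ShapeModuleIrreducible.
Variables (R : realType) (n : nat) (q l : R[i]) (D : set R[i]).
Local Notation C := R[i].
Hypotheses (q0 : q != 0) (hD : content_range q l D).
Variable p : placed_skew_shape D n.

Local Notation la := (outer p).
Local Notation mu := (inner p).
Local Notation hla := (outer_partition p).
Local Notation hmu := (inner_partition p).
Local Notation T := (shape_T q l p).
Local Notation X := (shape_X l p).
Local Notation V := (shape_module q l p).
Local Notation bw := (box_weight l (p := p)).
Implicit Types (N : filling p) (i : 'I_n.-1) (j : 'I_n) (b : box la mu).

Lemma shape_X_coord j (y : shape_space p) (L : tableau p) :
  X j y L = bw (val L j) * y L.
Proof.
pose z : shape_space p := [ffun L : tableau p => bw (val L j) * y L].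
have zE (L' : tableau p) : z L' = bw (val L' j) * y L' by rewrite /z ffunE.
suff -> : X j y = z by [].
rewrite {1}(tab_vec_sum y) (tab_vec_sum z) linear_sum; apply: eq_bigr => L' _.
by rewrite linearZ /= shape_XE scalerA mulrC zE.
Qed.

Lemma lker_shape_X j : lker (X j) == 0%VS.
Proof.
rewrite -subv0; apply/subvP => y; rewrite memv_ker memv0 => /eqP e.
apply/eqP/ffunP => L; apply: (mulfI (box_weight_neq0 l (val L j))).
by rewrite -shape_X_coord e !ffunE mulr0.
Qed.

Lemma shape_hecke : is_hecke_module q V.
Proof.
split; [|split; [|split; [|split; [|split]]]].
- move=> i i' /orP[h|h]; first exact: shape_commT.
  by apply/esym; exact: shape_commT.
- by move=> i i' ii; exact: shape_braid.
- by move=> i; exact: shape_mulT.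
- by move=> j; apply/eqP; exact: lker_shape_X.
- move=> j k; move: (shape_XE l (p := p) j) (shape_XE l (p := p) k).
  rewrite /=; move: (X j) (X k) => f g fE gE.
  apply: tab_vec_lfun_ext => L; rewrite !comp_lfunE fE gE.
  by rewrite !lfunZ fE gE !scalerA mulrC.
move=> i g; apply: tab_vec_lfun_ext => L; set N := val L.
apply: (@opX_exp_T_weight _ _ _ V i g (fun j => bw (N j)) (tab_vec N)
  (tab_vec (swap_entries i N)) (swap_coef q l (N (fst_ix i)) (N (snd_ix i)))).
- exact: lker_shape_X.
- by move=> j; exact: box_weight_neq0.
- by rewrite (box_weight_eq hD); exact: (standard_adj_diag hla hmu i (valP L)).
- exact: tab_vec_weight.
- have -> : (fun j => bw (N j)) \o swap_ix i = fun j => bw (swap_entries i N j).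
    by apply: funext => j; rewrite swap_entries_out.
  exact: tab_vec_weight.
- exact: shape_TE.
Qed.

Definition tab_vecs : seq V := [seq (tab_vec (val L) : V) | L <- enum (tableau p)].

Lemma tab_vecs_basis : basis_of {:V} tab_vecs.
Proof.
have fullV : ({:V} <= <<tab_vecs>>)%VS.
  apply/subvP => y _; rewrite (tab_vec_sum y); apply: memv_suml => L _.
  apply/memvZ/memv_span/(map_f (fun L : tableau p => tab_vec (val L) : V)).
  exact: mem_enum.
by rewrite basisEdim fullV size_map -cardE dimvf /= /dim /= muln1.
Qed.

Lemma shape_calibrated : calibrated V.
Proof.
apply: (calibrated_of_basis tab_vecs_basis) => x j /mapP[L _ ->].
by exists (bw (val L j)); exact: shape_XE.
Qed.

Lemma tableau_ex : exists L : filling p, standard L.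
Proof.
have [L sL] := standard_ex la mu.
by rewrite (card_boxes p) in L sL *; exists L.
Qed.

Lemma tab_vec_neq0 (L : filling p) : standard L -> tab_vec L != 0.
Proof.
move=> sL; apply/eqP => /(congr1 (fun f : shape_space p => f (Sub L sL))) /eqP.
by rewrite !ffunE /= eqxx oner_eq0.
Qed.

Lemma tableau_weight_inj (L L' : tableau p) :
  (fun j => bw (val L j)) = (fun j => bw (val L' j)) -> L = L'.
Proof.
move=> e; apply/val_inj/(standard_unique hla hmu (valP L) (valP L')) => j.
by apply/eqP; rewrite -(box_weight_eq hD); apply/eqP; exact: (congr1 (fun f => f j) e).
Qed.

(** Separating weights puts some v_L1 into a nonzero submodule. Every other tableau is L1
    precomposed with a permutation w, and descending from w to 1 passes only through standard
    tableaux, with nonzero coefficients at each step. *)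
Lemma shape_irreducible : irreducible V.
Proof.
have [L0 sL0] := tableau_ex; split.
  move=> e; have := tab_vec_neq0 sL0.
  by rewrite -memv0 -[0%VS](e : fullv = _) memvf.
move=> U [TU [XU _]]; have [->|U0] := eqVneq U 0%VS; [by left|right].
have TUm i y : y \in U -> T i y \in U.
  by move=> yU; apply: subvP (TU i) _ _; exact: memv_img.
have y0 := vpick0 U; rewrite (negPf U0) in y0.
have yU := memv_pick U; set y : shape_space p := vpick U in y0 yU.
have [L1 yL1] : exists L, y L != 0.
  apply: contrapT => /forallNP h; case/negP: (negbT y0); apply/eqP/ffunP => L.
  by rewrite ffunE; have /negP/negPn/eqP := h L.
have L1U : tab_vec (val L1) \in U.
  pose c (L : tableau p) : V := y L *: tab_vec (val L).
  have /(_ L1 isT) : forall L, L \in predT -> c L \in U.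
    apply: (@weight_sum_mem R n V U (tableau p) predT
      (fun (L : tableau p) j => bw (val L j)) c) => //.
    - by move=> L _ j /=; rewrite /c lfunZ shape_XE !scalerA mulrC.
    - by move=> L L' _ _; exact: tableau_weight_inj.
    - by rewrite (_ : \sum_(L in predT) c L = y) // [RHS](tab_vec_sum y); exact: eq_bigl.
  by move/(memvZ (y L1)^-1); rewrite scalerA mulVf // scale1r.
pose act (w : 'S_n) : filling p := [ffun j => val L1 (w j)].
have actU w : standard (act w) -> tab_vec (act w) \in U.
  elim/ascent_ind: w => [_|w i asc IH sw].
    rewrite (_ : act 1%g = val L1) //; apply/ffunP => j.
    by rewrite ffunE perm1.
  have swE : swap_entries i (act (swap_ix i * w)%g) = act w.
    by apply/ffunP => j; rewrite !ffunE mul_swapE /swap_ix tpermK.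
  set b := val L1 (w (fst_ix i)); set b' := val L1 (w (snd_ix i)).
  have aL : act (swap_ix i * w)%g (fst_ix i) = b' by rewrite ffunE mul_swapL.
  have aR : act (swap_ix i * w)%g (snd_ix i) = b by rewrite ffunE mul_swapR.
  have lt : (fst_ix i < snd_ix i)%N by rewrite /=.
  have bne : b != b'.
    by rewrite (inj_eq (standard_inj (valP L1))) (inj_eq perm_inj) fst_neq_snd.
  (* Were the diagonals adjacent, b' would lie weakly northwest of b in the standard filling
     [act (swap_ix i * w)]. Then L1 would fill b' before b, whereas w ascends at i. *)
  have nadj : ~~ diag_adj b' b.
    apply/negP => adj.
    suff : (w (snd_ix i) < w (fst_ix i))%N by move=> h; have := ltn_trans h asc; rewrite ltnn.
    have [h3 h4] : (row b' <= row b)%N /\ (col b' <= col b)%N.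
      have h1 := standard_adj hla hmu sw lt; have h2 := standard_adjN hla hmu sw lt.
      by rewrite aL aR in h1 h2; case/orP: adj => /eqP; [move/h2|move/h1] => -[r c'];
        split=> //; exact: ltnW.
    by apply: (standard_lt hla hmu (valP L1)) => //; rewrite eq_sym.
  have sw0 : standard (act w).
    by rewrite -swE; apply: (standard_swap hla hmu sw); rewrite aL aR.
  have nd := standard_adj_diag hla hmu i sw0; rewrite !ffunE -/b -/b' in nd.
  have := TUm i _ (IH sw0); rewrite shape_TE // !ffunE -/b -/b'.
  rewrite -swE (swap_fillingK i _ : swap_entries i (swap_entries i _) = _).
  move=> h; have {}h : swap_coef q l b b' *: tab_vec (act (swap_ix i * w)%g) \in U.
    rewrite -(addKr (tcoef q (bw b) (bw b') *: tab_vec (act w)) (_ *: _)).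
    by rewrite -{2}swE memvD ?memvN ?memvZ // IH.
  have k0 : swap_coef q l b b' != 0 by apply: swap_coef_neq0 => //; rewrite diag_adjC.
  by move/(memvZ (swap_coef q l b b')^-1): h; rewrite scalerA mulVf // scale1r.
apply/eqP; rewrite eqEsubv subvf /=; apply/subvP => x _.
rewrite (tab_vec_sum x); apply: memv_suml => L _; apply: memvZ.
have /boolp.choice[g hg] : forall j, exists k, val L1 k = val L j.
  by move=> j; exact: (standard_onto (valP L1)).
have g_inj : injective g.
  by move=> j j' e; apply: (standard_inj (valP L)); rewrite -!hg e.
have Lw : val L = act (perm g_inj).
  by apply/ffunP => j; rewrite ffunE permE hg.
by rewrite Lw; apply: actU; rewrite -Lw; exact: (valP L).
Qed.

End ShapeModuleIrreducible.

(** * Isomorphic modules come from the same placed shape *)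

Section IsomorphicShapes.
Variables (R : realType) (n : nat) (q l : R[i]) (D : set R[i]).
Hypothesis hD : content_range q l D.
Variables p p' : placed_skew_shape D n.

(** The image of v_L is a nonzero weight vector, so each tableau in its support has the weight of L;
    injectivity of q^(2x) on D turns weights into contents. *)
Lemma iso_common_contents :
  isomorphic (shape_module q l p) (shape_module q l p') ->
  exists (L : tableau p) (L' : tableau p'),
    forall j, content (val L j) = content (val L' j).
Proof.
case=> f [/eqP kf [_ [_ fX]]]; have [L sL] := tableau_ex p.
pose y : shape_space p' := f (tab_vec L).
have [L' yL'] : exists L', y L' != 0.
  apply: contrapT => /forallNP h; case/negP: (tab_vec_neq0 sL).
  rewrite -memv0 -(eqP kf) memv_ker; apply/eqP/ffunP => L'.
  by rewrite ffunE; have /negP/negPn/eqP := h L'.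
exists (Sub L sL), L' => j.
apply: (q2pow_inj hD (content_in _) (content_in _)).
apply: (mulIf yL'); rewrite -[RHS]shape_X_coord.
have -> : shape_X l p' j y = q2pow l (content (L j)) *: y.
  by rewrite /y -[LHS](fX j) /= shape_XE lfunZ.
by rewrite !ffunE.
Qed.

Lemma iso_same_shape :
  isomorphic (shape_module q l p) (shape_module q l p') -> same_placed_shape p p'.
Proof.
case/iso_common_contents=> [[L sL] [[L' sL'] /= hc]].
have deq j k : diag (L' j) = diag (L' k) <-> diag (L j) = diag (L k).
  by rewrite -!content_eq !hc.
have dsucc j k : diag (L j) = diag (L k) + 1 <-> diag (L' j) = diag (L' k) + 1.
  by rewrite -!content_adj !hc.
have /boolp.choice[g Lg] := standard_onto sL.
have gL j : g (L j) = j by apply: (standard_inj sL); rewrite Lg.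
have /boolp.choice[g' Lg'] := standard_onto sL'.
have gL' j : g' (L' j) = j by apply: (standard_inj sL'); rewrite Lg'.
have hla := outer_partition p; have hmu := inner_partition p.
have hla' := outer_partition p'; have hmu' := inner_partition p'.
(* Boxes holding the same entry are matched. *)
exists (fun b => L' (g b)); split; [|split; [|split]].
- by exists (fun b => L (g' b)) => b; rewrite ?gL ?gL' ?Lg ?Lg'.
- by move=> b; rewrite -hc Lg.
- move=> b b'; rewrite -{1 2}(Lg b) -{1 2}(Lg b'); split=> -[er ec].
    apply: (transfer_right hla hmu hla' hmu' sL sL' _ _ er ec) => j k.
      exact: (deq j k).1.
    exact: (dsucc j k).1.
  apply: (transfer_right hla' hmu' hla hmu sL' sL _ _ er ec) => j k.
    exact: (deq j k).2.
  exact: (dsucc j k).2.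
- move=> b b'; rewrite -{1 2}(Lg b) -{1 2}(Lg b'); split=> -[ec er].
    apply: (transfer_down hla hmu hla' hmu' sL sL' _ _ ec er) => j k.
      exact: (deq j k).1.
    exact: (dsucc j k).1.
  apply: (transfer_down hla' hmu' hla hmu sL' sL _ _ ec er) => j k.
    exact: (deq j k).2.
  exact: (dsucc j k).2.
Qed.

End IsomorphicShapes.

(** * Skew shapes from sequences of diagonals *)

(* A partition read off its boundary: h d is the number of its boxes on the
   diagonal d, counted from row 0, hence the first row that the diagonal d meets
   outside of the partition. *)
Section BoundaryPartition.
Local Open Scope nat_scope.
Variables (h : nat -> nat) (B : nat).
Hypotheses (hB : h B = 0) (h_step : forall d, h d.+1 <= h d <= (h d.+1).+1).

Lemma boundary_antimono d e : d <= e -> h e <= h d.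
Proof.
elim: e => [|e IH]; first by rewrite leqn0 => /eqP ->.
rewrite leq_eqVlt => /orP[/eqP -> //|]; rewrite ltnS => /IH le.
by case/andP: (h_step e) => le1 _; exact: leq_trans le1 le.
Qed.

Lemma boundary_ex r : exists d, h d <= r.
Proof. by exists B; rewrite hB. Qed.

Definition boundary_width r := ex_minn (boundary_ex r).

Lemma boundary_widthE d r : (d < boundary_width r) = (r < h d).
Proof.
rewrite /boundary_width; case: ex_minnP => w wr wmin.
have [hd|hd] := ltnP r (h d).
  by rewrite ltnNge; apply/negP => /boundary_antimono; lia.
by rewrite ltnNge wmin.
Qed.

(** Row r has r boxes left of the diagonal 0, all of them included, and then those on the diagonals
    d < [boundary_width r], which are the d with r < h d. *)
Definition boundary_partition := mkseq (fun r => r + boundary_width r) (h 0).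

Lemma nth_boundary_partition r : r < h 0 ->
  nth 0 boundary_partition r = r + boundary_width r.
Proof. exact: nth_mkseq. Qed.

Lemma boundary_partitionP : is_partition boundary_partition.
Proof.
apply/andP; split.
  apply/(sortedP 0) => r; rewrite size_mkseq => rm.
  rewrite !nth_boundary_partition //; last exact: ltnW.
  suff : boundary_width r.+1 < boundary_width r by rewrite /=; lia.
  rewrite boundary_widthE; case e : (boundary_width r.+1) => [|w]; first exact: ltnW.
  have : r.+1 < h w by rewrite -boundary_widthE e.
  by have := h_step w; lia.
apply/negP => /mapP[r]; rewrite mem_iota add0n => /andP[_ rm] /esym/eqP.
rewrite addn_eq0 => /andP[_ /eqP w0].
by move: rm; rewrite -boundary_widthE w0.
Qed.

Lemma boundary_partition_lt r d : r < h 0 ->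
  (r + d < nth 0 boundary_partition r) = (r < h d).
Proof. by move=> rm; rewrite nth_boundary_partition // ltn_add2l boundary_widthE. Qed.

End BoundaryPartition.

Section DiagonalSequence.
Local Open Scope nat_scope.
Variables (n : nat) (dg : 'I_n -> nat).
Hypothesis dg_gt0 : forall i, 0 < dg i.
Hypothesis dg_between : forall i j : 'I_n, i < j -> dg i = dg j ->
  (exists2 k : 'I_n, i < k < j & dg k = (dg i).+1) /\
  (exists2 k : 'I_n, i < k < j & (dg k).+1 = dg i).

Definition diag_count d p : nat := #|[pred j : 'I_n | (dg j == d) && (j < p)]|.

Lemma diag_count0 d : diag_count d 0 = 0.
Proof. by apply: eq_card0 => j; rewrite inE /= andbF. Qed.

Lemma diag_countS d (p : 'I_n) : diag_count d p.+1 = diag_count d p + (dg p == d).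
Proof.
rewrite /diag_count (cardD1 p) inE /= ltnSn andbT addnC; congr (_ + _).
apply: eq_card => j; rewrite !inE ltnS leq_eqVlt /= -val_eqE /=.
by case: eqP => [->|_] /=; rewrite ?ltnn ?andbF.
Qed.

Lemma diag_count_lt d (i : 'I_n) p : dg i = d -> i < p ->
  diag_count d i < diag_count d p.
Proof.
move=> di ip; rewrite /diag_count [X in _ < X](cardD1 i) inE /= di eqxx ip add1n ltnS.
apply: subset_leq_card; apply/fintype.subsetP => j; rewrite !inE /= => /andP[-> ji].
by rewrite (ltn_trans ji ip) -val_eqE /= ltn_eqF.
Qed.

Lemma diag_count_ex d s p : p <= n -> s < diag_count d p ->
  exists2 i : 'I_n, dg i = d & diag_count d i = s.
Proof.
elim: p => [|p IH] pn; first by rewrite diag_count0.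
rewrite (diag_countS d (Ordinal pn)) /=.
have [sp _|ps] := ltnP s (diag_count d p); first exact: IH (ltnW pn) sp.
by case: eqP => [e|_] sp; [exists (Ordinal pn) => //=|]; lia.
Qed.

(* eps d tells whether the first entry on the diagonals d and d + 1 is on d + 1;
   it is true when both are empty. *)
Definition eps d : bool :=
  [forall j : 'I_n, (dg j == d) ==> [exists i : 'I_n, (i < j) && (dg i == d.+1)]].

(* The two cases tell on which of the diagonals d + 1 and d the next entry lies. *)
Lemma diag_count_alternate d p : p <= n ->
  (diag_count d p + eps d = (diag_count d.+1 p).+1 /\
     forall j : 'I_n, p <= j -> dg j = d ->
       exists2 i : 'I_n, p <= i < j & dg i = d.+1) \/
  (diag_count d p + eps d = diag_count d.+1 p /\
     forall j : 'I_n, p <= j -> dg j = d.+1 ->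
       exists2 i : 'I_n, p <= i < j & dg i = d).
Proof.
elim: p => [_|p IH pn].
  rewrite !diag_count0; case e : (eps d); [left|right]; split=> // j _ dj.
    move/forallP/(_ j): e; rewrite dj eqxx => /existsP[i /andP[ij /eqP di]].
    by exists i.
  have /forallPn[k] := negbT e; rewrite negb_imply => /andP[/eqP dk /existsPn nk].
  exists k => //=; have := nk j; rewrite dj eqxx andbT -leqNgt leq_eqVlt.
  by case/orP=> // /eqP/val_inj kj; move: dk; rewrite kj dj; lia.
pose P := Ordinal pn; have PE : P = p :> nat by [].
have next (e : nat) (Q : nat -> Prop) : dg P <> e ->
    (forall j : 'I_n, p <= j -> Q (dg j) -> exists2 i : 'I_n, p <= i < j & dg i = e) ->
    forall j : 'I_n, p < j -> Q (dg j) -> exists2 i : 'I_n, p < i < j & dg i = e.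
  move=> nP hQ j pj Qj; have [i /andP[pi ij] di] := hQ j (ltnW pj) Qj.
  exists i => //; rewrite ij andbT ltn_neqAle pi andbT.
  by apply/eqP => ip; apply: nP; rewrite -di; congr dg; apply: val_inj.
have := IH (ltnW pn); rewrite !(diag_countS _ P) /=.
have [dP|dP] := eqVneq (dg P) d.
  have -> : (dg P == d.+1) = false by rewrite dP; apply/eqP; lia.
  (* An entry on d cannot be at p when d + 1 is due: the promised earlier entry would lie in an
     empty interval. After it, [dg_between] makes d + 1 due. *)
  case=> -[e hj].
    by have [i /andP[]] := hj P (leqnn p) dP; rewrite PE; lia.
  left; split; first by lia.
  move=> j pj dj; have [[k hk dk] _] := dg_between (pj : P < j) (etrans dP (esym dj)).
  by exists k; rewrite ?dk ?dP.
have [dP'|dP'] := eqVneq (dg P) d.+1.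
  case=> -[e hj]; last first.
    by have [i /andP[]] := hj P (leqnn p) dP'; rewrite PE; lia.
  right; split; first by lia.
  move=> j pj dj; have [_ [k hk dk]] := dg_between (pj : P < j) (etrans dP' (esym dj)).
  by exists k => //; move: dk; rewrite dP' => -[].
case=> -[e hj]; [left|right]; split; try lia.
  by apply: (next d.+1 (fun x => x = d)) => //; exact/eqP.
by apply: (next d (fun x => x = d.+1)) => //; exact/eqP.
Qed.

Lemma diag_count_bounds d p : p <= n ->
  diag_count d.+1 p <= diag_count d p + eps d <= (diag_count d.+1 p).+1.
Proof. by move=> pn; case: (diag_count_alternate d pn) => -[-> _]; rewrite !leqnn ?leqnSn. Qed.

Definition diag_bound : nat := (\max_i dg i).+1.

(** The first boxes on d and d + 1 lie in the same row if the entry on d comes first, while the box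
    on d sits directly below the other if the entry on d + 1 comes first. So the starting row rises
    by [eps d] from d + 1 to d, beginning with 0 beyond all entries. *)
Definition inner_boundary d : nat := \sum_(d <= e < diag_bound) eps e.

Definition outer_boundary d : nat := inner_boundary d + diag_count d n.

Lemma diag_count_big d : diag_bound <= d -> diag_count d n = 0.
Proof.
move=> hd; apply: eq_card0 => j; rewrite inE /=; apply/negP => /andP[/eqP dj _].
by have := @leq_bigmax _ dg j; rewrite dj; move: hd; rewrite /diag_bound; lia.
Qed.

Lemma inner_boundaryS d : d < diag_bound ->
  inner_boundary d = eps d + inner_boundary d.+1.
Proof. by move=> hd; rewrite /inner_boundary big_ltn. Qed.

Lemma inner_boundary_big d : diag_bound <= d -> inner_boundary d = 0.
Proof. by move=> hd; rewrite /inner_boundary big_geq. Qed.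

Lemma inner_boundary_step d :
  inner_boundary d.+1 <= inner_boundary d <= (inner_boundary d.+1).+1.
Proof.
have [hd|hd] := ltnP d diag_bound; last by rewrite !inner_boundary_big // ltnW.
by rewrite (inner_boundaryS hd); case: (eps d); lia.
Qed.

Lemma outer_boundary_step d :
  outer_boundary d.+1 <= outer_boundary d <= (outer_boundary d.+1).+1.
Proof.
rewrite /outer_boundary; have [hd|hd] := ltnP d diag_bound; last first.
  by rewrite !inner_boundary_big ?diag_count_big // ltnW.
by rewrite (inner_boundaryS hd); have := diag_count_bounds d (leqnn n); lia.
Qed.

(** Diagonal 0 carries no entry, as all indices are positive; this gives both partitions the same
    number of rows and the same boxes left of it. *)
Lemma outer_boundary0 : outer_boundary 0 = inner_boundary 0.
Proof.
rewrite /outer_boundary [diag_count 0 n]eq_card0 ?addn0 // => j; rewrite inE /=.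
by have := dg_gt0 j; case: (dg j).
Qed.

Lemma outer_boundary_end : outer_boundary diag_bound = 0.
Proof. by rewrite /outer_boundary inner_boundary_big ?diag_count_big. Qed.

Lemma inner_boundary_end : inner_boundary diag_bound = 0.
Proof. exact: inner_boundary_big. Qed.

Local Notation la := (boundary_partition outer_boundary_end).
Local Notation mu := (boundary_partition inner_boundary_end).

Lemma outer_shapeP : is_partition la.
Proof. exact: boundary_partitionP outer_boundary_step. Qed.

Lemma inner_shapeP : is_partition mu.
Proof. exact: boundary_partitionP inner_boundary_step. Qed.

Lemma shape_rowP r d : r < inner_boundary 0 ->
  (nth 0 mu r <= r + d < nth 0 la r) = (inner_boundary d <= r < outer_boundary d).
Proof.
move=> rm; rewrite leqNgt (boundary_partition_lt _ inner_boundary_step) //.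
by rewrite (boundary_partition_lt _ outer_boundary_step) ?outer_boundary0 // -leqNgt.
Qed.

Lemma shape_included : included mu la.
Proof.
move=> r; have [rm|rm] := ltnP r (inner_boundary 0); last first.
  by rewrite !nth_default // size_mkseq // outer_boundary0.
rewrite leqNgt; apply/negP => lt.
have rl : r <= nth 0 la r.
  by rewrite nth_boundary_partition ?outer_boundary0 // leq_addr.
have e : nth 0 la r = r + (nth 0 la r - r) by rewrite subnKC.
have := lt; rewrite {1}e (boundary_partition_lt _ inner_boundary_step) // => h1.
have : ~~ (nth 0 la r < nth 0 la r) by rewrite ltnn.
rewrite {1}e (boundary_partition_lt _ outer_boundary_step) ?outer_boundary0 //.
by rewrite (leq_trans h1) // leq_addr.
Qed.

Definition entry_row (i : 'I_n) : nat := inner_boundary (dg i) + diag_count (dg i) i.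

Lemma entry_row_lt i : entry_row i < outer_boundary (dg i).
Proof. by rewrite ltn_add2l; exact: diag_count_lt. Qed.

Lemma entry_box_ex i : exists b : box la mu, row b = entry_row i /\ col b = entry_row i + dg i.
Proof.
have rm : entry_row i < inner_boundary 0.
  rewrite -outer_boundary0; apply: leq_trans (entry_row_lt i) _.
  exact: (boundary_antimono outer_boundary_step).
have := shape_rowP (dg i) rm; rewrite entry_row_lt leq_addr => /andP[h1 h2].
exact: (box_ex outer_shapeP h1 h2).
Qed.

(** Equal rows mean that [diag_count (dg i) i + eps (dg i)] is the number of entries on the next
    diagonal before j. If j came before i, that diagonal would hold more entries before i than
    alternation allows. *)
Lemma entry_right (i j : 'I_n) : dg j = (dg i).+1 -> entry_row i = entry_row j -> i < j.
Proof.
move=> dj er; have hd : dg i < diag_bound.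
  by rewrite /diag_bound ltnS; exact: leq_bigmax.
rewrite ltnNge leq_eqVlt; apply/negP => /orP[/eqP/val_inj e|ji].
  by move: dj; rewrite e; lia.
have := diag_count_lt dj ji; have := diag_count_bounds (dg i) (ltnW (ltn_ord i)).
by move: er; rewrite /entry_row dj inner_boundaryS //; lia.
Qed.

Lemma entry_down (i j : 'I_n) : dg i = (dg j).+1 -> entry_row j = (entry_row i).+1 -> i < j.
Proof.
move=> di er; have hd : dg j < diag_bound.
  by rewrite /diag_bound ltnS; exact: leq_bigmax.
rewrite ltnNge leq_eqVlt; apply/negP => /orP[/eqP/val_inj e|ji].
  by move: di; rewrite e; lia.
have := diag_count_lt erefl ji; have := diag_count_bounds (dg j) (ltnW (ltn_ord i)).
by move: er; rewrite /entry_row di inner_boundaryS //; lia.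
Qed.

Lemma diag_sequence_tableau : exists (la mu : seq nat) (L : {ffun 'I_n -> box la mu}),
  [/\ is_partition la, is_partition mu, included mu la, standard L &
    forall i, diag (L i) = (dg i)%:Z].
Proof.
have /boolp.choice[f hf] := entry_box_ex.
pose L : {ffun 'I_n -> box la mu} := [ffun i => f i].
have LE (i : 'I_n) : L i = f i by rewrite ffunE.
clearbody L.
have rowL (i : 'I_n) : row (L i) = entry_row i by rewrite LE; case: (hf i).
have colL (i : 'I_n) : col (L i) = entry_row i + dg i by rewrite LE; case: (hf i).
have diagL (i : 'I_n) : diag (L i) = (dg i)%:Z by rewrite /diag rowL colL; lia.
have injL : injective L.
  move=> i j e; have dij : dg i = dg j by have := diagL i; rewrite e diagL; lia.
  have := rowL i; rewrite e rowL /entry_row dij => /addnI eij.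
  have [lt|lt|/val_inj //] := ltngtP i j.
    by have := diag_count_lt dij lt; rewrite eij ltnn.
  by have := diag_count_lt erefl lt; rewrite eij ltnn.
have ontoL b : exists i : 'I_n, L i = b.
  have rm : row b < inner_boundary 0.
    have <- : size la = inner_boundary 0 by rewrite size_mkseq outer_boundary0.
    exact: ltn_ord.
  have bb := box_bounds b.
  have rc : row b <= col b.
    apply: leq_trans (proj1 (andP bb)).
    by rewrite nth_boundary_partition // leq_addr.
  have := shape_rowP (col b - row b) rm; rewrite subnKC // bb => /esym/andP[h1 h2].
  have s : row b - inner_boundary (col b - row b) < diag_count (col b - row b) n.
    by rewrite ltn_subLR.
  have [i di ci] := diag_count_ex (leqnn n) s.
  have ri : row (L i) = row b by rewrite rowL /entry_row di ci subnKC.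
  exists i; apply: box_ext => //.
  by rewrite colL -rowL ri di subnKC.
exists la, mu, L; split=> //; [exact: outer_shapeP | exact: inner_shapeP | |].
  exact: shape_included.
apply/and4P; split.
- exact/injectiveP.
- by apply/forallP => b; have [i <-] := ontoL b; exact: codom_f.
- apply/forallP => i; apply/forallP => j; apply/implyP => /andP[/eqP er ec].
  (* Only neighbours are controlled by [entry_right]; convexity supplies the boxes in between, one
     column at a time. *)
  have [m] := ubnP (col (L j) - col (L i)); elim: m i er ec => // m IH i er ec cm.
  have [c [rc cc]] := @box_between _ _ outer_shapeP inner_shapeP (L i) (L j)
    (row (L i)) (col (L i)).+1 ltac:(lia) ltac:(lia).
  have [k kc] := ontoL c; rewrite -{}kc in rc cc.
  have ik : i < k.
    by apply: entry_right; rewrite -?rowL //; have := colL k; rewrite cc colL -!rowL rc; lia.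
  have [e|ne] := eqVneq (col (L k)) (col (L j)).
    by have -> : j = k by apply/injL/box_ext => //; lia.
  by apply: (ltn_trans ik); apply: IH; lia.
- apply/forallP => i; apply/forallP => j; apply/implyP => /andP[/eqP ec er].
  have [m] := ubnP (row (L j) - row (L i)); elim: m i er ec => // m IH i er ec cm.
  have [c [rc cc]] := @box_between _ _ outer_shapeP inner_shapeP (L i) (L j)
    (row (L i)).+1 (col (L i)) ltac:(lia) ltac:(lia).
  have [k kc] := ontoL c; rewrite -{}kc in rc cc.
  have ik : i < k.
    by apply: entry_down; rewrite -?rowL //; have := colL k; rewrite cc colL -!rowL rc; lia.
  have [e|ne] := eqVneq (row (L k)) (row (L j)).
    by have -> : j = k by apply/injL/box_ext => //; lia.
  by apply: (ltn_trans ik); apply: IH; lia.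
Qed.

End DiagonalSequence.

(* Each class of numbers that differ by integers gets its own range of
   consecutive diagonals, with gaps between the ranges. *)
Lemma diag_index_ex (K : numDomainType) n (c : 'I_n -> K) :
  exists dg : 'I_n -> nat, [/\ forall i, (0 < dg i)%N,
    forall i j (e : int), `|e| <= 1 ->
      (dg j)%:Z = (dg i)%:Z + e <-> c j = c i + e%:~R &
    forall i j (m : int), c j - c i = m%:~R -> (dg i <= dg j)%N -> c i <= c j].
Proof.
pose zdiff (i j : 'I_n) := `[< exists m : int, c i - c j = m%:~R >].
have zdiffP i j : reflect (exists m : int, c i - c j = m%:~R) (zdiff i j) by exact: asboolP.
have zrefl i : zdiff i i by apply/zdiffP; exists 0; rewrite subrr.
have zsym i j : zdiff i j = zdiff j i.
  by apply/zdiffP/zdiffP => -[m e]; exists (- m); rewrite intrN -e opprB.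
have ztrans i j k : zdiff i j -> zdiff j k -> zdiff i k.
  move=> /zdiffP[m e] /zdiffP[m' e']; apply/zdiffP; exists (m + m').
  by rewrite intrD -e -e' addrA subrK.
pose rep i := odflt i [pick j | zdiff i j].
have zrep i : zdiff i (rep i) by rewrite /rep; case: pickP => //= /(_ i).
have rep_eq i j : zdiff i j -> rep i = rep j.
  move=> ij; have e : zdiff i =1 zdiff j.
    move=> k; apply/idP/idP; apply: ztrans => //; by rewrite zsym.
  rewrite /rep (eq_pick e); case: pickP => // /(_ j); by rewrite zrefl.
have /boolp.choice[off hoff] : forall i, exists m : int, c i - c (rep i) = m%:~R.
  by move=> i; apply/zdiffP.
pose B := \max_i `|off i|%N.
have offB i : (`|off i| <= B)%N by exact: leq_bigmax.
(* Offsets lie in [-B, B]; blocks of width 2B + 3 keep indices of different classes at least 3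
   apart, and the shift B + 1 makes all indices positive. *)
pose dg i := absz ((rep i)%:Z * (2 * B%:Z + 3) + off i + B%:Z + 1).
have dgE i : (dg i)%:Z = (rep i)%:Z * (2 * B%:Z + 3) + off i + B%:Z + 1.
  by rewrite /dg; have := offB i; nia.
have dg_same i j (e : int) : rep i = rep j ->
    (dg j)%:Z = (dg i)%:Z + e <-> c j = c i + e%:~R.
  move=> r; have cj : c j = c i + (off j - off i)%:~R.
    by rewrite intrB -!hoff r; ring.
  rewrite !dgE r cj; split=> [h|/addrI/(@intr_inj K) h]; last by lia.
  by congr (_ + _%:~R); lia.
exists dg; split.
- by move=> i; have := dgE i; have := offB i; nia.
- move=> i j e e1; split=> [h|h].
    suff r : rep i = rep j by apply/(dg_same i j e r).
    apply: val_inj; move: h; rewrite !dgE; have := offB i; have := offB j => hj hi.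
    have W : 0 <= 2 * B%:Z + 3 by lia.
    have [lt|lt|//] := ltngtP (rep i) (rep j).
      have d : 0 <= (rep j)%:Z - (rep i)%:Z - 1 by lia.
      by have := mulr_ge0 d W; lia.
    have d : 0 <= (rep i)%:Z - (rep j)%:Z - 1 by lia.
    by have := mulr_ge0 d W; lia.
  apply/dg_same => //; apply: rep_eq; apply/zdiffP; exists (- e).
  by rewrite h opprD addrA subrr sub0r intrN.
- move=> i j m h le; have r : rep i = rep j.
    by apply: rep_eq; rewrite zsym; apply/zdiffP; exists m.
  have [k dk] : exists k, dg j = (dg i + k)%N by exists (dg j - dg i)%N; rewrite subnKC.
  have /(dg_same i j _ r) -> : (dg j)%:Z = (dg i)%:Z + k%:Z by rewrite dk.
  by rewrite lerDl ler0n.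
Qed.

(** * From a weight to a placed skew shape, and the classification *)

Lemma placed_shape_ex (R : realType) (n : nat) (q l : R[i]) (D : set R[i])
    (t : 'I_n -> R[i]) : content_range q l D -> (forall j, t j != 0) ->
  (forall j k : 'I_n, (j < k)%N -> t j = t k ->
    (exists2 m : 'I_n, (j < m < k)%N & t m = q ^+ 2 * t j) /\
    (exists2 m : 'I_n, (j < m < k)%N & t j = q ^+ 2 * t m)) ->
  exists (p : placed_skew_shape D n) (L : tableau p),
    forall j, q2pow l (content (val L j)) = t j.
Proof.
move=> hD t0 tb.
have /boolp.choice[c hc] : forall j, exists x, D x /\ q2pow l x = t j.
  by move=> j; have [x Dx xt] := q2pow_onto hD (t0 j); exists x.
have Dc j : D (c j) by case: (hc j).
have ct j : q2pow l (c j) = t j by case: (hc j).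
have [dg [dg0 dgP dgle]] := diag_index_ex c.
have dg_eq i j : dg j = dg i <-> c j = c i.
  have := dgP i j 0 isT; rewrite !addr0 => <-; split=> [->|] //; lia.
have dg_succ i j : dg j = (dg i).+1 <-> c j = c i + 1.
  by rewrite -[1]/(1%:~R) -(dgP i j 1 isT); split; lia.
have t_succ i j : t j = q ^+ 2 * t i <-> dg j = (dg i).+1.
  by rewrite dg_succ -(q2pow_succ hD (Dc i) (Dc j)) !ct.
have between (i j : 'I_n) : (i < j)%N -> dg i = dg j ->
    (exists2 k : 'I_n, (i < k < j)%N & dg k = (dg i).+1) /\
    (exists2 k : 'I_n, (i < k < j)%N & (dg k).+1 = dg i).
  move=> ij /dg_eq cij; have tij : t i = t j by rewrite -!ct cij.
  have [[k hk /t_succ ek] [k' hk' /t_succ ek']] := tb i j ij tij.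
  by split; [exists k|exists k'].
have [la [mu [L [hla hmu hin sL dL]]]] := diag_sequence_tableau dg0 between.
have /boolp.choice[g Lg] := standard_onto sL.
have gL j : g (L j) = j by apply: (standard_inj sL); rewrite Lg.
have dE b : diag b = (dg (g b))%:Z by rewrite -dL Lg.
have card : #|box la mu| = n.
  by rewrite -[RHS]card_ord; apply/esym/(bij_eq_card (f := L)); exists g.
have mono b b' : box_before b b' ->
    (exists m : int, c (g b') - c (g b) = m%:~R) -> c (g b) <= c (g b').
  move=> bb [m hm]; apply: dgle hm _.
  by move: bb; rewrite /box_before !dE; case/orP => [|/andP[/eqP]]; lia.
have adj b b' : c (g b') = c (g b) + 1 <-> diag b' = diag b + 1.
  by rewrite -dg_succ !dE; split; lia.
have eqd b b' : c (g b) = c (g b') <-> diag b = diag b'.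
  by rewrite -dg_eq !dE; split; lia.
(* A box receives the content of the entry it holds, g being the inverse of the tableau. *)
pose p := @PlacedSkewShape R D n la mu hla hmu hin card (fun b => c (g b))
  (fun b => Dc (g b)) mono adj eqd.
exists p, (Sub (L : filling p) sL) => j /=.
by rewrite gL ct.
Qed.

Lemma calibrated_weight_ex (R : realType) n (M : hecke_data R n) :
  calibrated M -> {:M}%VS <> 0%VS ->
  exists t (v : M), weight_vector t v /\ v != 0.
Proof.
move=> [b [bM hb]] M0; have dM : (0 < \dim {:M})%N by rewrite lt0n dimv_eq0; exact/eqP.
pose k := Ordinal dM; have /boolp.choice[t ht] := hb k.
exists t, (tnth b k); split=> //.
by apply: (basis_not0 bM); exact: mem_tnth.
Qed.

Theorem theorem4p1 (R : realType) (n : nat) (q : R[i]) (l : R[i])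
    (D : set R[i]) (hq0 : q <> 0)
    (hq : forall m : nat, (0 < m)%N -> q ^+ m <> 1)
    (hD : content_range q l D) :
  (forall p : placed_skew_shape D n,
     is_hecke_module q (shape_module q l p) /\
     calibrated (shape_module q l p) /\
     irreducible (shape_module q l p)) /\
  (forall p p' : placed_skew_shape D n,
     isomorphic (shape_module q l p) (shape_module q l p') ->
     same_placed_shape p p') /\
  (forall M : hecke_data R n,
     is_hecke_module q M -> irreducible M -> calibrated M ->
     exists p : placed_skew_shape D n, isomorphic M (shape_module q l p)).
Proof.
have q0 : q != 0 by exact/eqP.
have q4 : q ^+ 4 != 1 by apply/eqP/hq.
split; [|split].
- move=> p; split; [|split].
  + exact: shape_hecke.
  + exact: shape_calibrated.
  + exact: shape_irreducible.
- exact: iso_same_shape.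
move=> M hM iM cM; have [t [v [tv v0]]] := calibrated_weight_ex cM iM.1.
have [p [L hL]] := placed_shape_ex hD (fun j => weight_neq0 hM j tv v0)
  (fun j k => weight_between hM q0 q4 cM tv v0).
exists p.
(* The vector v of M and the tableau vector of L have the same weight t. *)
apply: (irreducible_weight_iso q0 q4 hM cM iM _ _ _ tv v0
  (v' := tab_vec (val L) : shape_module q l p)).
- exact: shape_hecke.
- exact: shape_calibrated.
- exact: shape_irreducible.
- by move=> j; rewrite -hL; exact: shape_XE.
- exact: tab_vec_neq0 (valP L).
Qed.
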